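(* Let $l\ge 1$, let $X$ be a pure $d$-dimensional simplicial complex and let $1\le k\le d-1$. Assume: (i) $X$ is a $\gamma$-coboundary expander with coefficients in the symmetric group $S_l$, for some $\gamma>0$; (ii) $X$ is a $1$-up agreement expander in dimension $k$: there is $\alpha>0$ such that for every $k$-dimensional assignment $F$, $\Pr[F^{\sigma_1}|_{\sigma_1\cap\sigma_2}\ne F^{\sigma_2}|_{\sigma_1\cap\sigma_2}]\ge \alpha\cdot \mathrm{dist}(F,\mathcal A)$, where $\tau\in X(k+1)$ is sampled according to $w_X$ and $\{\sigma_1,\sigma_2\}$ is a uniformly random pair of distinct $k$-dimensional subfaces of $\tau$, and $\mathcal A$ is the set of agreeing $k$-dimensional assignments. Then there exist a constant $\beta>0$ (depending only on $k,\gamma,\alpha$) and a randomized tester which, given oracle access to a $k$-dimensional $l$-assignment $L$ (each query returns a single local function $L^\sigma_i$), makes at most $3l$ queries, accepts with probability $1$ every agreeing $2$-locally-differing $l$-assignment, and rejects every $2$-locally-differing $l$-assignment $L$ with probability at least $\beta\cdot\mathrm{dist}(L,\mathcal A_l)$, where $\mathcal A_l$ is the set of agreeing $l$-assignments.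
   Context: A pure $d$-dimensional simplicial complex $X$ is a finite family of finite sets closed under subsets whose maximal faces all have $d+1$ elements; $X(i)$ is the set of faces with $i+1$ elements. Weights: $w_X(\sigma)=|\{\tau\in X(d):\sigma\subseteq\tau\}|/(\binom{d+1}{|\sigma|}|X(d)|)$; the norm of $S\subseteq X(i)$ is $\|S\|=\sum_{\sigma\in S}w_X(\sigma)$. The link of $\sigma\in X$ is $X_\sigma=\{\tau\setminus\sigma:\sigma\subseteq\tau\in X\}$ (with its own weights). For a group $G$: $C^0(X;G)$ = functions $X(0)\to G$; $C^1(X;G)$ = functions $f$ on ordered pairs $(u,v)$ with $\{u,v\}\in X(1)$ and $f(v,u)=f(u,v)^{-1}$; $d_0g(u,v)=g(u)g(v)^{-1}$; $d_1f(u,v,w)=f(u,v)f(v,w)f(w,u)$ for $\{u,v,w\}\in X(2)$. $B^0$ = constant functions, $B^1=\mathrm{im}\, d_0$. The norm $\|f\|$ of a cochain is the norm of the set of faces where $f\neq 1$, $\mathrm{dist}(f,g)=\|fg^{-1}\|$, and distance to a set is the minimum. $h_0(X;G)=\min_{g\notin B^0}\|d_0g\|/\mathrm{dist}(g,B^0)$, $h_1(X;G)=\min_{f\notin B^1}\|d_1 f\|/\mathrm{dist}(f,B^1)$. $X$ is a $\gamma$-coboundary expander with coefficients in $G$ if $h_0(X_\sigma;G)\ge\gamma$ and $h_1(X_\sigma;G)\ge\gamma$ for every face $\sigma$ (including $\emptyset$) of dimension less than $d-2$. A $k$-dimensional assignment is $F=(F^\sigma)_{\sigma\in X(k)}$ with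 $F^\sigma:\sigma\to\{0,1\}$; it is agreeing if some $g:X(0)\to\{0,1\}$ has $g|_\sigma=F^\sigma$ for all $\sigma$; $\mathrm{dist}(F,F')=\|\{\sigma:F^\sigma\ne F'^\sigma\}\|$. A $k$-dimensional $l$-assignment is $L=(L^\sigma_i)_{\sigma\in X(k),i\in[l]}$ with $L^\sigma_i:\sigma\to\{0,1\}$; $\mathrm{dist}(L,M)=\sum_{\sigma}w_X(\sigma)\,|\{i:L^\sigma_i\ne M^\sigma_i\}|/l$. $L$ is agreeing if there are $g_1,\dots,g_l:X(0)\to\{0,1\}$ and permutations $\pi_\sigma$ of $[l]$ with $L^\sigma_{\pi_\sigma(i)}=g_i|_\sigma$ for all $\sigma,i$. $L$ is $2$-locally-differing if for every $\sigma\in X(k)$ and $i\ne j$ there are two distinct vertices $x_1\neq x_2$ of $\sigma$ with $L^\sigma_i(x_t)\ne L^\sigma_j(x_t)$, $t=1,2$. *)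

(* Defs.v *)
From HB Require Import structures.
From mathcomp Require Import all_boot all_order all_algebra all_fingroup.
From mathcomp Require Import reals.
Set Implicit Arguments. Unset Strict Implicit. Unset Printing Implicit Defensive.
Import Order.TTheory GRing.Theory Num.Theory.
Local Open Scope ring_scope.

Section Defs.
Variable R : realType.
Variable V : finType.

Definition closed_under_subsets (X : {set {set V}}) : Prop :=
  forall tau sigma : {set V}, tau \in X -> sigma \subset tau -> sigma \in X.

Definition pure_complex (X : {set {set V}}) (d : nat) : Prop :=
  closed_under_subsets X /\
  forall tau : {set V}, tau \in X ->
    (forall tau' : {set V}, tau' \in X -> tau \subset tau' -> tau' = tau) ->
    #|tau| = d.+1.

Definition faces (X : {set {set V}}) (i : nat) : {set {set V}} :=
  [set s in X | #|s| == i.+1].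

Definition weight (X : {set {set V}}) (d : nat) (sigma : {set V}) : R :=
  #|[set tau in faces X d | sigma \subset tau]|%:R /
  ('C(d.+1, #|sigma|)%:R * #|faces X d|%:R).

Definition snorm (X : {set {set V}}) (d : nat) (S : {set {set V}}) : R :=
  \sum_(s in S) weight X d s.

Definition link (X : {set {set V}}) (sigma : {set V}) : {set {set V}} :=
  [set tau :\: sigma | tau in [set t in X | sigma \subset t]].

Definition minf (T : finType) (x0 : T) (f : T -> R) : R :=
  \big[Num.min/f x0]_(x : T) f x.

Variable l : nat.
Notation G := {perm 'I_l}.

Definition norm0 (Y : {set {set V}}) (e : nat) (g : V -> G) : R :=
  snorm Y e [set s in faces Y 0 | [exists v, (s == [set v]) && (g v != 1%g)]].

Definition norm1 (Y : {set {set V}}) (e : nat) (f : V -> V -> G) : R :=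
  snorm Y e [set s in faces Y 1 |
    [exists u, exists v, [&& s == [set u; v], u != v & f u v != 1%g]]].

Definition norm2 (Y : {set {set V}}) (e : nat) (h : V -> V -> V -> G) : R :=
  snorm Y e [set s in faces Y 2 |
    [exists u, exists v, exists w,
       [&& s == [set u; v; w], u != v, v != w, u != w & h u v w != 1%g]]].

Definition d0 (g : V -> G) : V -> V -> G := fun u v => (g u * (g v)^-1)%g.
Definition d1 (f : V -> V -> G) : V -> V -> V -> G :=
  fun u v w => (f u v * f v w * f w u)%g.

Definition is_C1 (Y : {set {set V}}) (f : V -> V -> G) : Prop :=
  forall u v, [set u; v] \in faces Y 1 -> u != v -> f v u = ((f u v)^-1)%g.

Definition in_B0 (Y : {set {set V}}) (g : V -> G) : Prop :=
  exists c : G, forall v, [set v] \in faces Y 0 -> g v = c.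

Definition in_B1 (Y : {set {set V}}) (f : V -> V -> G) : Prop :=
  exists g : V -> G, forall u v, [set u; v] \in faces Y 1 -> u != v -> f u v = d0 g u v.

Definition dist_B0 (Y : {set {set V}}) (e : nat) (g : V -> G) : R :=
  minf (1%g : G) (fun c : G => norm0 Y e (fun v => (g v * c^-1)%g)).

Definition dist_B1 (Y : {set {set V}}) (e : nat) (f : V -> V -> G) : R :=
  minf [ffun=> 1%g] (fun g : {ffun V -> G} =>
    norm1 Y e (fun u v => (f u v * (d0 g u v)^-1)%g)).

Definition h0_ge (Y : {set {set V}}) (e : nat) (gamma : R) : Prop :=
  forall g : V -> G, ~ in_B0 Y g -> gamma <= norm1 Y e (d0 g) / dist_B0 Y e g.

Definition h1_ge (Y : {set {set V}}) (e : nat) (gamma : R) : Prop :=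
  forall f : V -> V -> G, is_C1 Y f -> ~ in_B1 Y f ->
    gamma <= norm2 Y e (d1 f) / dist_B1 Y e f.

(* gamma-coboundary expander with coefficients in S_l: for every face sigma
   (incl. the empty face) of dimension #|sigma|-1 < d-2, the link (of
   dimension d - #|sigma|) has h0, h1 >= gamma *)
Definition coboundary_expander (X : {set {set V}}) (d : nat) (gamma : R) : Prop :=
  forall sigma : {set V}, sigma \in X -> (#|sigma|.+1 < d)%N ->
    h0_ge (link X sigma) (d - #|sigma|) gamma /\
    h1_ge (link X sigma) (d - #|sigma|) gamma.

End Defs.

Section Assign.
Variable R : realType.
Variable V : finType.

Definition locdiff (sigma : {set V}) (f h : V -> bool) : bool :=
  [exists x in sigma, f x != h x].

(* k-dimensional assignment: F sigma : sigma -> {0,1} (values outside sigma irrelevant) *)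
Definition assignment := {set V} -> V -> bool.

(* dist(F, A): minimum over agreeing assignments, i.e. over global g *)
Definition dist_agree (X : {set {set V}}) (d k : nat) (F : assignment) : R :=
  minf [ffun=> false] (fun g : {ffun V -> bool} =>
    snorm R X d [set s in faces X k | locdiff s (F s) g]).

(* Pr over tau ~ w_X on X(k+1) and a uniformly random pair of distinct
   k-subfaces sigma1 = tau\{x}, sigma2 = tau\{y} of tau, that F disagrees
   on sigma1 /\ sigma2 *)
Definition disagree_prob (X : {set {set V}}) (d k : nat) (F : assignment) : R :=
  \sum_(tau in faces X k.+1) weight R X d tau *
    (#|[set p : V * V | [&& p.1 \in tau, p.2 \in tau, p.1 != p.2 &
        locdiff ((tau :\ p.1) :&: (tau :\ p.2)) (F (tau :\ p.1)) (F (tau :\ p.2))]]|%:R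
     / (k.+2 * k.+1)%:R).

Definition agreement_expander (X : {set {set V}}) (d k : nat) (alpha : R) : Prop :=
  forall F : assignment, disagree_prob X d k F >= alpha * dist_agree X d k F.

Variable l : nat.
Definition lassignment := {set V} -> 'I_l -> V -> bool.

Definition two_loc_diff (X : {set {set V}}) (k : nat) (L : lassignment) : Prop :=
  forall sigma : {set V}, sigma \in faces X k -> forall i j : 'I_l, i != j ->
    exists x1 x2, [/\ x1 \in sigma, x2 \in sigma, x1 != x2,
                      L sigma i x1 != L sigma j x1 & L sigma i x2 != L sigma j x2].

Definition agreeing_l (X : {set {set V}}) (k : nat) (L : lassignment) : Prop :=
  exists (g : 'I_l -> V -> bool) (pi : {set V} -> {perm 'I_l}),
    forall sigma : {set V}, sigma \in faces X k -> forall (i : 'I_l) x, x \in sigma ->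
      L sigma (pi sigma i) x = g i x.

Definition dist_l (X : {set {set V}}) (d k : nat) (L M : lassignment) : R :=
  \sum_(s in faces X k) weight R X d s *
    (#|[set i : 'I_l | locdiff s (L s i) (M s i)]|%:R / l%:R).

(* the agreeing l-assignment determined by g_1..g_l and permutations pi_sigma:
   M^sigma_{pi_sigma(i)} = g_i |_sigma *)
Definition agreeing_of (g : {ffun 'I_l -> {ffun V -> bool}})
    (pi : {ffun {set V} -> {perm 'I_l}}) : lassignment :=
  fun s j => g (((pi s)^-1)%g j).

Definition dist_agree_l (X : {set {set V}}) (d k : nat) (L : lassignment) : R :=
  minf ([ffun=> [ffun=> false]], [ffun=> 1%g])
    (fun gp : {ffun 'I_l -> {ffun V -> bool}} * {ffun {set V} -> {perm 'I_l}} =>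
       dist_l X d k L (agreeing_of gp.1 gp.2)).

(* deterministic adaptive query algorithms: each query (sigma, i) returns the
   local function L^sigma_i (as the function sigma -> {0,1}, padded by false) *)
Inductive qtree : Type :=
| QLeaf of bool
| QAsk of {set V} & 'I_l & ({ffun V -> bool} -> qtree).

Fixpoint depth_le (t : qtree) (n : nat) : Prop :=
  match t with
  | QLeaf _ => True
  | QAsk _ _ c => match n with 0 => False | n'.+1 => forall a, depth_le (c a) n' end
  end.

Fixpoint run (X : {set {set V}}) (k : nat) (t : qtree) (L : lassignment) : bool :=
  match t with
  | QLeaf b => b
  | QAsk s i c =>
      run X k (c [ffun x => [&& s \in faces X k, x \in s & L s i x]]) L
  end.

(* randomized tester = finite probability distribution p over deterministic
   query algorithms T; acceptance probability *)
Definition accept_prob (X : {set {set V}}) (k n : nat) (p : 'I_n -> R)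
    (T : 'I_n -> qtree) (L : lassignment) : R :=
  \sum_(j < n) p j * (run X k (T j) L)%:R.

End Assign.

(* Main.v *)
Require Import Defs.
From HB Require Import structures.
From mathcomp Require Import all_boot all_order all_algebra all_fingroup.
From mathcomp Require Import boolp reals.
From mathcomp Require Import ring zify.
Set Implicit Arguments. Unset Strict Implicit. Unset Printing Implicit Defensive.
Import Order.TTheory GRing.Theory Num.Theory.
Local Open Scope ring_scope.

(** The tester queries the full lists of three faces and accepts iff the lists
can be reindexed so that they agree pairwise on intersections.  The triple is
either two independent faces containing a random [a] with [#|a| = k], or the
three [k]-faces [b+x+y], [b+y+z], [b+x+z] for a random flag [b < b+x+y+z] with
[#|b| = k-1].

For the soundness, fix for every [a] with [#|a| = k] the list on [a] induced by
the best face above [a], and label the inclusion [a < a+u] by the permutation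
matching the list of [a+u] to it.  This is possible up to the rejection
probability, and it is unambiguous because [L] is 2-locally-differing and
[a+u] has only one vertex more than [a].  Labels are then extended to all
inclusions [b < b+x] by downward induction on [#|b|]: passing from [b+x] to
[b+y] through [b+x+y] is a 1-cochain on the link of [b], whose coboundary is
nontrivial only on triangles containing a defect one level up (for [#|b| = k-1],
only where the tester rejects), so by coboundary expansion it is close to the
coboundary of some [g], and [b < b+x] is labelled by the inverse of [g x].  Most
squares [b, b+x, b+y, b+x+y] then commute.  When all squares below a face [s]
commute, the product of the labels along a maximal chain below [s] does not
depend on the chain; reindexing the list of [s] by this product splits [L] into
[l] ordinary assignments, to which agreement expansion applies. *)

(** * Weights and links *)

Section Sums.
Variables (V : finType) (M : nmodType).
Implicit Types (b : {set V}).

(** Sending [(r, x)] to [(r :\ x, x)] turns flags read from the top into flags read from the bottom;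
    the summations across levels below rest on this. *)
Lemma sum_facets s (F : {set V} -> V -> M) :
  \sum_(r : {set V} | #|r| == s.+1) \sum_(x in r) F (r :\ x) x =
  \sum_(b : {set V} | #|b| == s) \sum_(x | x \notin b) F b x.
Proof.
rewrite !pair_big_dep /=.
rewrite (reindex_onto (fun p : {set V} * V => (p.2 |: p.1, p.2))
  (fun p => (p.1 :\ p.2, p.2))) /=; last first.
  by move=> [r x] /= /andP[_ xr]; rewrite setD1K.
apply: eq_big => [[b x]|[b x]] /=.
  rewrite cardsU1 setU11 andbT -pair_eqE /= eqxx andbT.
  case xb: (x \in b) => /=; last by rewrite setU1K ?xb ?eqxx ?andbT // add1n eqSS.
  by rewrite andbF; apply/negP => /andP[_ /eqP] e; move: xb; rewrite -e !inE eqxx.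
by move=> /andP[_ /eqP [->]].
Qed.

Lemma sum_facets2 s (F : {set V} -> V -> V -> M) :
  \sum_(r : {set V} | #|r| == s.+2) \sum_(x in r) \sum_(y in r :\ x) F (r :\ x :\ y) y x =
  \sum_(b : {set V} | #|b| == s) \sum_(y | y \notin b) \sum_(x | x \notin y |: b) F b y x.
Proof.
rewrite (sum_facets s.+1 (fun r x => \sum_(y in r) F (r :\ y) y x)).
rewrite -(sum_facets s (fun b y => \sum_(x | x \notin y |: b) F b y x)).
apply: eq_bigr => r _; rewrite exchange_big; apply: eq_bigr => y yr.
by rewrite setD1K.
Qed.

(** Each [a] of size [s.+1] arises as [x |: b] once for each of its elements. *)
Lemma sum_extensions s (F : {set V} -> M) :
  \sum_(b : {set V} | #|b| == s) \sum_(x | x \notin b) F (x |: b) =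
  (\sum_(a : {set V} | #|a| == s.+1) F a) *+ s.+1.
Proof.
rewrite -(sum_facets s (fun b x => F (x |: b))) -sumrMnl; apply: eq_bigr => a /eqP <-.
by rewrite -sumr_const; apply: eq_bigr => x xa; rewrite setD1K.
Qed.

Lemma sum_swap b (F : V -> V -> M) :
  \sum_(x | x \notin b) \sum_(y | y \notin x |: b) F x y =
  \sum_(x | x \notin b) \sum_(y | y \notin x |: b) F y x.
Proof.
rewrite (exchange_big_dep (fun y => y \notin b)) /=; last first.
  by move=> x y _; rewrite !inE negb_or => /andP[].
apply: eq_bigr => y yb; apply: eq_bigl => x.
by rewrite !inE !negb_or yb andbT eq_sym andbC.
Qed.

End Sums.

Lemma setUD_sub (T : finType) (a b : {set T}) : a \subset b -> a :|: (b :\: a) = b.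
Proof. by move=> ab; rewrite -[RHS](setID b a) (setIidPr ab). Qed.

Lemma exists_minf (R : realType) (T : finType) (x0 : T) (f : T -> R) :
  exists x, minf x0 f = f x.
Proof.
rewrite /minf; elim/big_ind: _ => [|_ _ [x ->] [y ->]|x _].
- by exists x0.
- by rewrite /Num.min; case: ifP => _; [exists x | exists y].
- by exists x.
Qed.

Lemma minf_le (R : realType) (T : finType) (x0 : T) (f : T -> R) x :
  minf x0 f <= f x.
Proof. by rewrite /minf bigmin_le_cond. Qed.

Section Weights.
Variables (R : realType) (V : finType) (X : {set {set V}}) (d : nat).
Hypothesis X_closed : closed_under_subsets X.
Implicit Types (b s t : {set V}).

Local Notation W := (weight R X d).
Definition codegree s := #|[set tau in faces X d | s \subset tau]|.

Lemma weight_ge0 s : 0 <= W s.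
Proof. by rewrite /weight divr_ge0 // mulr_ge0. Qed.

Lemma weight_notin s : s \notin X -> W s = 0.
Proof.
move=> sX; rewrite /weight (_ : [set _ in _ | _] = set0) ?cards0 ?mul0r //.
apply/setP => t; rewrite !inE; apply/negP => /andP[/andP[tX _] st].
by rewrite (X_closed tX st) in sX.
Qed.

Lemma weight_neq0 s : W s != 0 -> s \in X.
Proof. by case sX: (s \in X) => //; rewrite weight_notin ?sX ?eqxx. Qed.

(* As [W] vanishes outside [X], sums weighted by [W] may range over all sets of
   the given size. *)
Lemma sum_faces k (F : {set V} -> R) :
  \sum_(s in faces X k) W s * F s = \sum_(s : {set V} | #|s| == k.+1) W s * F s.
Proof.
rewrite [RHS](bigID (mem X)) /= [X in _ + X]big1 ?addr0 => [|s /andP[_ sX]].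
  by apply: eq_bigl => s; rewrite inE andbC.
by rewrite weight_notin ?mul0r.
Qed.

Lemma codegree_up b :
  (\sum_(x | x \notin b) codegree (x |: b) = codegree b * (d.+1 - #|b|))%N.
Proof.
transitivity (\sum_(x | x \notin b) \sum_(t in faces X d | x |: b \subset t) 1)%N.
  by apply: eq_bigr => x _; rewrite /codegree sum1dep_card.
rewrite (exchange_big_dep (fun t => (t \in faces X d) && (b \subset t))) /=; last first.
  by move=> x t _; rewrite subUset sub1set => /and3P[-> _ ->].
rewrite /codegree -[#|_|]sum1_card big_distrl /=.
apply: eq_big => [t|t /andP[tX bt]]; first by rewrite !inE.
rewrite mul1n sum1dep_card.
have -> : #|[set x | x \notin b & (t \in faces X d) && (x |: b \subset t)]| = #|t :\: b|.
  by apply: eq_card => x; rewrite in_set in_setD tX subUset sub1set bt andbT.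
by move: tX; rewrite inE => /andP[_ /eqP <-]; rewrite cardsD (setIidPr bt).
Qed.

Lemma weightE s : W s = (codegree s)%:R / ('C(d.+1, #|s|)%:R * #|faces X d|%:R).
Proof. by []. Qed.

(** This is [codegree_up] after normalization; the factor [#|b|.+1] comes from
    [(n - m) * 'C(n, m) = m.+1 * 'C(n, m.+1)] with [n = d.+1] and [m = #|b|]. *)
Lemma weight_up b : (#|b| <= d)%N ->
  \sum_(x | x \notin b) W (x |: b) = W b *+ #|b|.+1.
Proof.
move=> bd.
transitivity (\sum_(x | x \notin b) (codegree (x |: b))%:R /
   ('C(d.+1, #|b|.+1)%:R * #|faces X d|%:R) : R).
  by apply: eq_bigr => x xb; rewrite weightE cardsU1 xb add1n.
rewrite -mulr_suml -natr_sum codegree_up natrM weightE -mulr_natr.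
have h : (d.+1 - #|b|)%:R * 'C(d.+1, #|b|)%:R = #|b|.+1%:R * 'C(d.+1, #|b|.+1)%:R :> R.
  by rewrite -!natrM mul_bin_left.
have h1 : 'C(d.+1, #|b|)%:R != 0 :> R by rewrite pnatr_eq0 -lt0n bin_gt0 leqW.
have h2 : 'C(d.+1, #|b|.+1)%:R != 0 :> R by rewrite pnatr_eq0 -lt0n bin_gt0.
have -> : (d.+1 - #|b|)%:R = #|b|.+1%:R * 'C(d.+1, #|b|.+1)%:R / 'C(d.+1, #|b|)%:R :> R.
  by rewrite -h mulfK.
rewrite !invfM; move: ('C(d.+1, #|b|)%:R : R) ('C(d.+1, #|b|.+1)%:R : R) h1 h2 => u v h1 h2.
by move: (#|faces X d|%:R^-1) => n; field; rewrite ?h1 ?h2.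
Qed.

Lemma sum_weight_up b (c : R) : (#|b| <= d)%N ->
  \sum_(x | x \notin b) W (x |: b) * c = #|b|.+1%:R * (W b * c).
Proof. by move=> bd; rewrite -mulr_suml weight_up // mulr_natl mulrnAl. Qed.

(** By [weight_up] the total weight is the same on every level. At [set0] it is [1], or [0] when
    there is no face of dimension [d] and the division is by zero. *)
Lemma sum_weight_le1 n : (n <= d.+1)%N -> \sum_(a : {set V} | #|a| == n) W a <= 1.
Proof.
elim: n => [_|n IH nd].
  rewrite (big_pred1 set0) => [|a]; last by rewrite cards_eq0.
  rewrite weightE cards0 bin0 mul1r.
  have -> : codegree set0 = #|faces X d|.
    by apply: eq_card => t; rewrite in_set sub0set andbT.
  have [->|h] := eqVneq (#|faces X d|%:R : R) 0; first by rewrite mul0r.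
  by rewrite divff.
have := sum_extensions n W; rewrite (eq_bigr (fun b => W b *+ n.+1)) => [|b /eqP bs].
  by rewrite sumrMnl => /eqP; rewrite eqrMn2r => /eqP <-; rewrite IH // ltnW.
by rewrite weight_up bs.
Qed.

Lemma mem_link b t : b \in X -> (t \in link X b) = [disjoint t & b] && (b :|: t \in X).
Proof.
move=> bX; apply/imsetP/andP => [[r]|[tb btX]].
  rewrite inE => /andP[rX br] ->; split; first by rewrite disjoint_sym disjoints_subset setCD subsetUr.
  by rewrite setUD_sub.
exists (b :|: t); first by rewrite inE btX subsetUl.
by rewrite setDUl setDv set0U; apply/esym/setDidPl.
Qed.

End Weights.

Lemma codegree_link (V : finType) (X : {set {set V}}) d (b t : {set V}) :
  b \in X -> (#|b| <= d)%N -> [disjoint t & b] ->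
  codegree (link X b) (d - #|b|) t = codegree X d (b :|: t).
Proof.
move=> bX bd tb; rewrite /codegree.
rewrite -[in RHS](card_in_imset (f := fun r => r :\: b)); last first.
  move=> r r'; rewrite !in_set !subUset => /and3P[_ br _] /and3P[_ br' _] e.
  by rewrite -(setID r b) -(setID r' b) (setIidPr br) (setIidPr br') e.
apply: eq_card => r; apply/idP/imsetP.
  rewrite in_set [r \in faces _ _]in_set mem_link // => /andP[/andP[/andP[rb rX] /eqP rd] tr].
  exists (b :|: r); last by rewrite setDUl setDv set0U; apply/esym/setDidPl.
  rewrite in_set [_ \in faces _ _]in_set rX setUS // andbT cardsU disjoint_setI0 1?disjoint_sym //.
  by rewrite cards0 subn0 rd addnS subnKC /= ?eqxx.
case=> q /setIdP[/setIdP[qX /eqP qd]]; rewrite subUset => /andP[bq tq] ->.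
rewrite in_set [_ \in faces _ _]in_set mem_link // setUD_sub // qX.
rewrite cardsD (setIidPr bq) qd subSn // eqxx !andbT.
rewrite disjoint_sym disjoints_subset setCD subsetUr /=.
by rewrite subsetD tq.
Qed.

(** Choosing [b] and then [t] in its link amounts to choosing [b :|: t] with one of its
    ['C(#|b| + #|t|, #|t|)] splittings. If [b] has codegree [0], both sides vanish. *)
Lemma weight_link (R : realType) (V : finType) (X : {set {set V}}) d (b t : {set V}) :
  closed_under_subsets X ->
  b \in X -> (#|b| <= d)%N -> (#|b| + #|t| <= d.+1)%N -> [disjoint t & b] ->
  weight R X d (b :|: t) =
  weight R (link X b) (d - #|b|) t * weight R X d b * 'C(#|b| + #|t|, #|t|)%:R.
Proof.
move=> Xc bX bd btd tb; rewrite !weightE codegree_link //.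
have -> : #|faces (link X b) (d - #|b|)| = codegree X d b.
  transitivity (codegree (link X b) (d - #|b|) set0).
    by apply: eq_card => r; rewrite in_set sub0set andbT.
  by rewrite codegree_link ?setU0 // -setI_eq0 set0I.
have -> : #|b :|: t| = (#|b| + #|t|)%N.
  by rewrite cardsU disjoint_setI0 1?disjoint_sym // cards0 subn0.
have h : 'C(d.+1, #|b| + #|t|)%:R * 'C(#|b| + #|t|, #|t|)%:R =
  'C(d.+1, #|b|)%:R * 'C((d - #|b|).+1, #|t|)%:R :> R.
  rewrite -!natrM -subSn //; congr _%:R.
  have f1 := bin_fact btd; have f2 := bin_fact (leq_addl #|b| #|t|).
  have f3 := bin_fact (leqW bd).
  have f4 : ('C(d.+1 - #|b|, #|t|) * (#|t|`! * (d.+1 - (#|b| + #|t|))`!) = (d.+1 - #|b|)`!)%N.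
    by rewrite subnDA bin_fact // leq_subRL // leqW.
  rewrite addnK in f2; apply/eqP.
  rewrite -(eqn_pmul2r (fact_gt0 #|t|)) -(eqn_pmul2r (fact_gt0 #|b|)).
  rewrite -(eqn_pmul2r (fact_gt0 (d.+1 - (#|b| + #|t|)))); apply/eqP.
  transitivity (d.+1)`!; first by rewrite -f1 -f2; ring.
  by rewrite -f3 -f4; ring.
have c0 : codegree X d b = 0%N -> codegree X d (b :|: t) = 0%N.
  move=> /eqP; rewrite cards_eq0 => /eqP e; apply: eq_card0 => r; apply/negP => /setIdP[rX].
  by rewrite subUset => /andP[br _]; have := in_set0 r; rewrite -e in_set rX br.
have [/c0 ->|cb] := eqVneq (codegree X d b) 0%N; first by rewrite !mul0r.
have n0 m n : (n <= m)%N -> 'C(m, n)%:R != 0 :> R by move=> ?; rewrite pnatr_eq0 -lt0n bin_gt0.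
have h1 := n0 _ _ btd; have h2 := n0 _ _ (leqW bd).
have h3 : 'C((d - #|b|).+1, #|t|)%:R != 0 :> R by rewrite n0 // -subSn // leq_subRL // leqW.
rewrite -(pnatr_eq0 R) in cb.
have -> : 'C(#|b| + #|t|, #|t|)%:R =
  'C(d.+1, #|b|)%:R * 'C((d - #|b|).+1, #|t|)%:R / 'C(d.+1, #|b| + #|t|)%:R :> R.
  by rewrite -h mulrC mulKf.
rewrite !invfM; move: (#|faces X d|%:R^-1) => n.
by field; rewrite ?h1 ?h2 ?h3 ?cb.
Qed.

(** * Squares and triangles of labels *)

(** Clears the denominator in [h1_ge] and names a nearest coboundary. Coboundaries, and cochains at
    distance [0] from them, satisfy the product form trivially. *)
Lemma h1_ge_cobound (R : realType) (V : finType) l (Y : {set {set V}}) e (gamma : R)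
    (f : V -> V -> {perm 'I_l}) :
  0 < gamma -> h1_ge l Y e gamma -> is_C1 Y f ->
  exists g : {ffun V -> {perm 'I_l}},
    gamma * Defs.norm1 R Y e (fun u v => (f u v * (d0 g u v)^-1)%g) <= norm2 R Y e (d1 f).
Proof.
move=> gamma0 hY fC.
have n2 : 0 <= norm2 R Y e (d1 f) by apply: sumr_ge0 => s _; exact: weight_ge0.
have [[g fg]|nB] := EM (in_B1 Y f).
  exists [ffun v => g v]; rewrite /Defs.norm1 /snorm big1 ?mulr0 // => s /setIdP[sY].
  case/existsP=> u /existsP[v /and3P[/eqP es uv]].
  by rewrite fg -?es // /d0 !ffunE mulgV eqxx.
have [g eg] := exists_minf [ffun=> 1%g] (fun g : {ffun V -> {perm 'I_l}} =>
    Defs.norm1 R Y e (fun u v => (f u v * (d0 g u v)^-1)%g)).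
exists g; have := hY f fC nB; rewrite /dist_B1 eg.
set n1 := Defs.norm1 _ _ _ _.
have n1_ge0 : 0 <= n1 by apply: sumr_ge0 => s _; exact: weight_ge0.
have [-> _|n10] := eqVneq n1 0; first by rewrite mulr0.
by rewrite ler_pdivlMr // lt_def n10.
Qed.

Lemma setU2_cons (T : finType) (b : {set T}) x y : b :|: [set x; y] = y |: (x |: b).
Proof. by rewrite setUC -setUA setUCA. Qed.

Section Squares.
Variables (R : realType) (V : finType) (X : {set {set V}}) (d l : nat).
Hypothesis X_closed : closed_under_subsets X.
Local Notation W := (weight R X d).
Local Notation G := {perm 'I_l}.
Implicit Types (b : {set V}) (h : {set V} -> V -> G).

Definition square_fails h b x y := (h b x * h (x |: b) y)%g != (h b y * h (y |: b) x)%g.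

Definition link_cochain h b : V -> V -> G := fun u v => (h (u |: b) v * (h (v |: b) u)^-1)%g.

Definition square_defect h b : R :=
  \sum_(x | x \notin b) \sum_(y | y \notin x |: b)
    W (y |: (x |: b)) * (square_fails h b x y)%:R.

Definition triangle_defect h b : R :=
  \sum_(x | x \notin b) \sum_(y | y \notin x |: b) \sum_(z | z \notin y |: (x |: b))
    W (z |: (y |: (x |: b))) * (d1 (link_cochain h b) x y z != 1%g)%:R.

Lemma link_cochain_C1 h b (Y : {set {set V}}) : is_C1 Y (link_cochain h b).
Proof. by move=> u v _ _; rewrite /link_cochain invMg invgK. Qed.

(* The factor 4 counts all ordered pairs of elements of the edge [e]. *)
Lemma square_defect_le_sum b (S : {set {set V}}) (f : V -> V -> bool) :
  (forall e, e \in S -> #|e| = 2%N) ->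
  (forall x y, x \notin b -> y \notin x |: b -> y |: (x |: b) \in X -> f x y ->
     [set x; y] \in S) ->
  \sum_(x | x \notin b) \sum_(y | y \notin x |: b) W (y |: (x |: b)) * (f x y)%:R
  <= 4 * \sum_(e in S) W (b :|: e).
Proof.
move=> S2 fS.
pose c (p : V * V) e : R := ([set p.1; p.2] == e)%:R * W (b :|: e).
have c0 p e : 0 <= c p e by rewrite mulr_ge0 ?weight_ge0.
apply: (@le_trans _ _ (\sum_p \sum_(e in S) c p e)).
  rewrite pair_big_dep /= [leRHS](bigID (fun p : V * V => (p.1 \notin b) && (p.2 \notin p.1 |: b))) /=.
  rewrite -[leLHS]addr0 lerD //; last by apply: sumr_ge0 => p _; apply: sumr_ge0.
  apply: ler_sum => -[x y] /= /andP[xb yb].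
  have sX : W (y |: (x |: b)) * (f x y)%:R != 0 -> [set x; y] \in S.
    rewrite mulf_eq0 negb_or => /andP[/(weight_neq0 X_closed) wX].
    by case fxy: (f x y); rewrite ?eqxx // => _; apply: fS.
  have [->|/sX eS] := eqVneq (W (y |: (x |: b)) * (f x y)%:R) 0; first exact: sumr_ge0.
  rewrite (bigD1 [set x; y]) //= -[leLHS]addr0 lerD ?sumr_ge0 // /c eqxx mul1r.
  rewrite setU2_cons.
  by case: (f x y); rewrite ?mulr1 // mulr0 weight_ge0.
rewrite exchange_big mulr_sumr /=; apply: ler_sum => e eS.
rewrite -mulr_suml ler_wpM2r ?weight_ge0 // -natr_sum ler_nat.
rewrite (_ : 4%N = #|setX e e|); last by rewrite cardsX S2.
rewrite -sum1_card [leqRHS]big_mkcond /=; apply: leq_sum => -[x y] _ /=.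
case: eqP => //= <-; by rewrite in_setX !inE !eqxx orbT.
Qed.

(** Every [t] in [S] comes from at least one ordered triple, and a triple determines its [t]. *)
Lemma sum_le_triangle_defect b (S : {set {set V}}) (f : V -> V -> V -> bool) :
  (forall t, t \in S -> exists x y z, [/\ t = [set x; y; z], x \notin b, y \notin x |: b,
      z \notin y |: (x |: b) & f x y z]) ->
  \sum_(t in S) W (b :|: t) <=
  \sum_(x | x \notin b) \sum_(y | y \notin x |: b) \sum_(z | z \notin y |: (x |: b))
    W (z |: (y |: (x |: b))) * (f x y z)%:R.
Proof.
move=> Sf; rewrite pair_big_dep pair_big_dep /=.
pose P (p : V * V * V) := [&& (p.1.1 \notin b) && (p.1.2 \notin p.1.1 |: b),
   p.2 \notin p.1.2 |: (p.1.1 |: b) & f p.1.1 p.1.2 p.2].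
pose t (p : V * V * V) := [set p.1.1; p.1.2; p.2].
have tE x y z : b :|: t (x, y, z) = z |: (y |: (x |: b)).
  by rewrite /t /= setUA setU2_cons setUC.
apply: (@le_trans _ _ (\sum_(s in S) \sum_(p | P p) (t p == s)%:R * W (b :|: s))).
  apply: ler_sum => s /Sf [x [y [z [-> xb yb zb fxyz]]]].
  rewrite (bigD1 (x, y, z)) /=; last by rewrite /P /= xb yb zb.
  rewrite /t /= eqxx mul1r -[leLHS]addr0 lerD ?sumr_ge0 // => p _.
  by rewrite mulr_ge0 ?weight_ge0.
rewrite exchange_big /= [leLHS]big_mkcond [leRHS]big_mkcond /=; apply: ler_sum => -[[x y] z] _.
rewrite /P /= andbA; case: ifP => [/andP[-> fxyz]|_]; last first.
  by case: ifP => // _; rewrite mulr_ge0 ?weight_ge0.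
rewrite fxyz mulr1 -tE.
have [tS|tS] := boolP (t (x, y, z) \in S); last first.
  rewrite big1 ?weight_ge0 // => s sS; case: eqP => [e|]; rewrite ?mul0r //.
  by rewrite e sS in tS.
rewrite (bigD1 (t (x, y, z))) //= eqxx mul1r big1 ?addr0 // => s /andP[_ /negPf].
by rewrite eq_sym => ->; rewrite mul0r.
Qed.

(** When [h' b] is the inverse of the nearest [g], the square on [x] and [y] fails exactly where the
    link cochain differs from [d0 g]. Leaving [h'] free allows a whole level to be filled at
    once. *)
Lemma link_square_defect (gamma : R) h b : 0 < gamma ->
  (#|b|.+1 < d)%N -> (b \in X -> h1_ge l (link X b) (d - #|b|) gamma) ->
  exists g : {ffun V -> G}, forall h', h' b =1 g ->
    (forall x, x \notin b -> h' (x |: b) =1 h (x |: b)) ->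
    gamma * square_defect h' b <= 4 * triangle_defect h b.
Proof.
move=> gamma0 bd hb.
have [bX|bX] := boolP (b \in X); last first.
  exists [ffun=> 1%g] => h' _ _; rewrite /square_defect big1 ?mulr0 => [|x xb].
    rewrite mulr_ge0 //; do 3 (apply: sumr_ge0 => ? _).
    by rewrite mulr_ge0 ?weight_ge0.
  rewrite big1 // => y yb; rewrite (weight_notin _ _ X_closed) ?mul0r //.
  by apply: contra bX => /X_closed; apply; rewrite setUCA subsetU // subsetUr orbT.
have [g hg] := h1_ge_cobound gamma0 (hb bX) (@link_cochain_C1 h b (link X b)).
exists [ffun v => (g v)^-1]%g => h' h'b h'x.
have linkD t : t \in link X b -> [disjoint t & b] by rewrite mem_link // => /andP[].
move: hg; rewrite /Defs.norm1 /norm2 /snorm; set S1 := [set _ in _ | _]; set S2 := [set _ in _ | _] => hg.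
have s1 : square_defect h' b <= 4 * \sum_(e in S1) W (b :|: e).
  apply: square_defect_le_sum => [e|x y xb yb yX].
    by move=> /setIdP[]; rewrite inE => /andP[_ /eqP].
  rewrite /square_fails !h'b !ffunE !h'x //; last first.
    by move: yb; rewrite !inE negb_or => /andP[].
  move=> fxy; move: (yb); rewrite !inE negb_or eq_sym => /andP[xy yb'].
  rewrite cards2 xy mem_link //= setUA (setUC b) -setUA (setUC b) setUCA yX !andbT.
  apply/andP; split; last first.
    apply/existsP; exists x; apply/existsP; exists y; rewrite eqxx xy /=.
    apply: contra fxy; rewrite /d0 /link_cochain => /eqP/eqP; rewrite -eq_mulgV1.
    by move=> /eqP/(canRL (mulgKV _)) ->; rewrite -mulgA mulKg.
  rewrite disjoints_subset subUset !sub1set !inE xb yb' //.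
have s2 : \sum_(t in S2) W (b :|: t) <= triangle_defect h b.
  apply: sum_le_triangle_defect => t /setIdP[]; rewrite inE => /andP[/linkD tb _].
  case/existsP=> x /existsP[y /existsP[z /and5P[/eqP et xy yz xz fx]]].
  exists x, y, z; move: tb; rewrite et disjoints_subset !subUset !sub1set !inE.
  by move=> /andP[/andP[xb yb] zb]; rewrite !negb_or ![z == _]eq_sym [y == _]eq_sym xb yb zb xy xz yz.
have bd' : (#|b| <= d)%N by lia.
have [/eqP W0|Wb] := eqVneq (W b) 0.
  suff -> : square_defect h' b = 0.
    rewrite mulr0 mulr_ge0 //; do 3 (apply: sumr_ge0 => ? _).
    by rewrite mulr_ge0 ?weight_ge0.
  apply: le_anti; rewrite [X in _ && X]sumr_ge0 ?andbT => [|x _]; last first.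
    by apply: sumr_ge0 => y _; rewrite mulr_ge0 ?weight_ge0.
  apply: (le_trans s1); rewrite big1 ?mulr0 // => e /setIdP[]; rewrite inE => /andP[/linkD eb /eqP e2] _.
  by rewrite weight_link ?e2 ?(eqP W0) ?mulr0 ?mul0r //; lia.
have Wb0 : 0 < W b by rewrite lt_def Wb weight_ge0.
move: s1 s2.
(* Link weights turn into weights of [X] with the factor ['C(#|b|.+2, 2)] on edges and
   ['C(#|b|.+3, 3)] on triangles; the first is at most the second, so no constant is lost. *)
rewrite (eq_bigr (fun e => weight R (link X b) (d - #|b|) e * (W b * 'C(#|b|.+2, 2)%:R))); last first.
  move=> e /setIdP[]; rewrite inE => /andP[/linkD eb /eqP e2] _.
  by rewrite (weight_link R X_closed bX bd') ?e2 ?addn2 ?mulrA //; lia.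
rewrite [X in _ -> X <= _ -> _](eq_bigr (fun e => weight R (link X b) (d - #|b|) e * (W b * 'C(#|b|.+3, 3)%:R))); last first.
  move=> e /setIdP[]; rewrite inE => /andP[/linkD eb /eqP e2] _.
  by rewrite (weight_link R X_closed bX bd') ?e2 ?addn3 ?mulrA //; lia.
move: Wb0; move: (W b) => w w0; rewrite -!mulr_suml => s1 s2.
apply: (le_trans (ler_wpM2l (ltW gamma0) s1)); rewrite mulrCA ler_wpM2l //.
apply: le_trans s2; rewrite !mulrA; apply: ler_pM => //.
- by rewrite !mulr_ge0 ?(ltW w0) ?(ltW gamma0) ?sumr_ge0 // => *; apply: weight_ge0.
- by rewrite ler_wpM2r ?(ltW w0).
- by rewrite ler_nat (binS #|b|.+2 2) leq_addl.
Qed.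

End Squares.

(** * Potentials *)

Lemma setD1C (T : finType) (A : {set T}) x y : A :\ x :\ y = A :\ y :\ x.
Proof. by rewrite !setDDl setUC. Qed.

Section TripleSums.
Variables (V : finType) (M : nmodType) (b : {set V}).
Implicit Type F : V -> V -> V -> M.

Definition sum3 F : M :=
  \sum_(x | x \notin b) \sum_(y | y \notin x |: b) \sum_(z | z \notin y |: (x |: b)) F x y z.

Lemma sum3_swap12 F : sum3 F = sum3 (fun x y z => F y x z).
Proof.
rewrite /sum3 sum_swap; apply: eq_bigr => x _; apply: eq_bigr => y _.
by rewrite setUCA.
Qed.

Lemma sum3_swap23 F : sum3 F = sum3 (fun x y z => F x z y).
Proof. by apply: eq_bigr => x _; rewrite sum_swap. Qed.

Lemma sum3D F F' : sum3 (fun x y z => F x y z + F' x y z) = sum3 F + sum3 F'.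
Proof.
rewrite /sum3 -big_split; apply: eq_bigr => x _; rewrite -big_split.
by apply: eq_bigr => y _; rewrite -big_split.
Qed.

End TripleSums.

Lemma ler_sum3 (R : numDomainType) (V : finType) (b : {set V}) (F F' : V -> V -> V -> R) :
  (forall x y z, x \notin b -> y \notin x |: b -> z \notin y |: (x |: b) ->
     F x y z <= F' x y z) -> sum3 b F <= sum3 b F'.
Proof. by move=> FF'; do 3 (apply: ler_sum => ? ?); exact: FF'. Qed.

(** Here [xy] stands for the label from [b+x] to [b+x+y], and so on, while [p], [q], [r] are the
    labels into [b+x+y+z] from [b+x+y], [b+x+z], [b+y+z]. The hypotheses are the squares at [b+x],
    [b+y], [b+z]. *)
Lemma triangle_of_squares (gT : finGroupType) (xy xz yx yz zx zy p q r : gT) :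
  (xy * p = xz * q -> yx * p = yz * r -> zx * q = zy * r ->
   xy * yx^-1 * (yz * zy^-1) * (zx * xz^-1) = 1)%g.
Proof.
move=> /(canRL (mulgK _)) -> /(canRL (mulgK _)) -> /(canRL (mulgK _)) ->.
by rewrite !invMg !invgK !mulgA !(mulgKV, mulgK) mulgV.
Qed.

Section Labels.
Variables (R : realType) (V : finType) (X : {set {set V}}) (d l : nat).
Hypothesis X_closed : closed_under_subsets X.
Local Notation W := (weight R X d).
Local Notation G := {perm 'I_l}.
Implicit Types (b r : {set V}) (h : {set V} -> V -> G).
Local Notation square_defect := (square_defect R X d).
Local Notation triangle_defect := (triangle_defect R X d).

Lemma eq_square_defect h h' b : h b =1 h' b ->
  (forall x, x \notin b -> h (x |: b) =1 h' (x |: b)) ->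
  square_defect h b = square_defect h' b.
Proof.
move=> hb hx; apply: eq_bigr => x xb; apply: eq_bigr => y.
by rewrite !inE negb_or => /andP[_ yb]; rewrite /square_fails !hb !hx.
Qed.

Lemma eq_triangle_defect h h' b :
  (forall x, x \notin b -> h (x |: b) =1 h' (x |: b)) ->
  triangle_defect h b = triangle_defect h' b.
Proof.
move=> hx; apply: eq_bigr => x xb; apply: eq_bigr => y yb; apply: eq_bigr => z zb.
have yb' : y \notin b by move: yb; rewrite !inE negb_or => /andP[].
have zb' : z \notin b by move: zb; rewrite !inE !negb_or => /and3P[].
by rewrite /d1 /link_cochain !hx.
Qed.

(** In the induction [j] counts the filled levels below [k]. The triangle defect at [b] involves
    only labels one level up, so filling the level of [b] leaves it unchanged, as well as all
    defects at higher levels. *)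
Lemma fill_labels (k : nat) (gamma : R) h0 : 0 < gamma -> (k < d)%N ->
  (forall b, b \in X -> (#|b|.+1 < d)%N -> h1_ge l (link X b) (d - #|b|) gamma) ->
  exists h, (forall b, #|b| = k -> h b =1 h0 b) /\
    forall b, (#|b| < k)%N -> gamma * square_defect h b <= 4 * triangle_defect h b.
Proof.
move=> gamma0 kd hX.
suff: forall j, (j <= k)%N -> exists h, (forall b, #|b| = k -> h b =1 h0 b) /\
    forall b, (k - j <= #|b| < k)%N ->
      gamma * square_defect h b <= 4 * triangle_defect h b.
  move=> /(_ k (leqnn k)) [h [hk hb]]; exists h; split=> // b bk.
  by apply: hb; rewrite subnn.
elim=> [_|j IH jk].
  by exists h0; split=> // b; rewrite subn0 => /andP[/leq_ltn_trans h /h]; rewrite ltnn.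
have [h [hk hb]] := IH (ltnW jk).
(* The choice is made for all [b] simultaneously; where [#|b|.+1 < d] fails the claim is vacuous and
   a constant serves. *)
have /fin_all_exists [g hg] b : exists g : {ffun V -> G}, (#|b|.+1 < d)%N ->
    forall h', h' b =1 g -> (forall x, x \notin b -> h' (x |: b) =1 h (x |: b)) ->
    gamma * square_defect h' b <= 4 * triangle_defect h b.
  have [bd|bd] := boolP (#|b|.+1 < d)%N; last by exists [ffun=> 1%g].
  have [g hg] := link_square_defect X_closed h gamma0 bd (fun bX => hX b bX bd).
  by exists g.
exists (fun b => if #|b| == (k - j.+1)%N then g b : V -> G else h b); split=> [b bk|b /andP[bj bk]].
  by rewrite ifF ?bk; [apply: hk | apply/eqP; lia].
have [e|ne] := eqVneq #|b| (k - j.+1)%N.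
  have hx x : x \notin b ->
    (if #|x |: b| == (k - j.+1)%N then g (x |: b) : V -> G else h (x |: b)) =1 h (x |: b).
    by move=> xb; rewrite cardsU1 xb ifF //; apply/eqP; lia.
  rewrite (eq_triangle_defect hx); apply: hg => //; first by lia.
  by rewrite e eqxx.
rewrite (@eq_square_defect _ h) ?(@eq_triangle_defect _ h); first by apply: hb; lia.
- by move=> x xb; rewrite cardsU1 xb ifF //; apply/eqP; lia.
- by rewrite (negPf ne).
- by move=> x xb; rewrite cardsU1 xb ifF //; apply/eqP; lia.
Qed.

(** By [triangle_of_squares] a nontrivial coboundary on a triangle forces a failing square at
    [x |: b], [y |: b] or [z |: b]. The three contributions are equal by symmetry, and each [a] is
    some [x |: b] in [s.+1] ways. *)
Lemma triangle_defect_le h s :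
  \sum_(b : {set V} | #|b| == s) triangle_defect h b <=
  (3 * s.+1)%:R * \sum_(a : {set V} | #|a| == s.+1) square_defect h a.
Proof.
pose F b x y z := W (z |: (y |: (x |: b))) * (square_fails h (x |: b) y z)%:R.
have -> : (3 * s.+1)%:R * \sum_(a : {set V} | #|a| == s.+1) square_defect h a =
    \sum_(b : {set V} | #|b| == s) (sum3 b (F b) + sum3 b (F b) + sum3 b (F b)).
  have e : \sum_(b : {set V} | #|b| == s) sum3 b (F b) =
     (\sum_(a : {set V} | #|a| == s.+1) square_defect h a) *+ s.+1.
    by rewrite -sum_extensions.
  by rewrite !big_split /= e natrM -mulr_natl; ring.
apply: ler_sum => b _.
rewrite [X in _ + X + _]sum3_swap12 [X in _ <= _ + X]sum3_swap12 [X in _ <= _ + X]sum3_swap23.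
rewrite -!sum3D; apply: ler_sum3 => x y z xb yb zb.
have W0 := weight_ge0 R X d (z |: (y |: (x |: b))).
rewrite /F [z |: (x |: (y |: b))](_ : _ = z |: (y |: (x |: b))); last by rewrite [x |: (y |: b)]setUCA.
rewrite [y |: (x |: (z |: b))](_ : _ = z |: (y |: (x |: b))); last first.
  by rewrite [x |: (z |: b)]setUCA [RHS]setUCA.
rewrite -!mulrDr ler_wpM2l // -!natrD ler_nat.
case: eqP => //= d1N; rewrite lt0n; apply/negP; rewrite !addn_eq0 !eqb0 !negbK.
move=> /andP[/andP[/eqP sx /eqP sy] /eqP sz]; apply: d1N.
move: sx sy sz; rewrite [x |: (y |: b)]setUCA [x |: (z |: b)]setUCA [y |: (z |: b)]setUCA.
exact: triangle_of_squares.
Qed.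

Lemma square_defect_ge0 h b : 0 <= square_defect h b.
Proof. by do 2 (apply: sumr_ge0 => ? _); rewrite mulr_ge0 ?weight_ge0. Qed.

(** Going down one level costs a factor of at most [(12 * k.+1)%:R / gamma], by [hk] and
    [triangle_defect_le]. Adding [1] makes the factor at least [1], so the single exponent [k]
    serves all levels. *)
Lemma sum_square_defect_le k (gamma T : R) h s : 0 < gamma ->
  (forall b, (#|b| < k.+1)%N -> gamma * square_defect h b <= 4 * triangle_defect h b) ->
  \sum_(b : {set V} | #|b| == k) triangle_defect h b <= T -> (s <= k)%N ->
  \sum_(b : {set V} | #|b| == s) square_defect h b <=
    4 / gamma * (1 + (12 * k.+1)%:R / gamma) ^+ k * T.
Proof.
move=> gamma0 hk hT sk.
have level n : (n <= k)%N -> \sum_(b : {set V} | #|b| == n) square_defect h b <=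
    4 / gamma * \sum_(b : {set V} | #|b| == n) triangle_defect h b.
  move=> nk; rewrite -mulrA mulrCA ler_pdivlMl // !mulr_sumr.
  by apply: ler_sum => b /eqP bn; apply: hk; lia.
have T0 : 0 <= T.
  by apply: le_trans hT; apply: sumr_ge0 => b _; do 3 (apply: sumr_ge0 => ? _); rewrite mulr_ge0 ?weight_ge0.
have c0 : 0 <= (12 * k.+1)%:R / gamma by rewrite divr_ge0 // ltW.
have c1 : 1 <= 1 + (12 * k.+1)%:R / gamma by rewrite lerDl.
set c := 1 + _ in c1 *.
suff H j : (j <= k)%N -> \sum_(b : {set V} | #|b| == (k - j)%N) square_defect h b <=
    4 / gamma * c ^+ j * T.
  rewrite -{1}(subKn sk); apply: (le_trans (H _ (leq_subr _ _))).
  rewrite ler_wpM2r // ler_wpM2l ?divr_ge0 ?(ltW gamma0) //.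
  by rewrite ler_weXn2l // leq_subr.
elim: j => [_|j IH jk].
  rewrite subn0 expr0 mulr1; apply: (le_trans (level k (leqnn k))).
  by rewrite ler_wpM2l // divr_ge0 // ltW.
apply: (le_trans (level _ (leq_subr _ _))).
apply: (le_trans (ler_wpM2l _ (triangle_defect_le _ _))); first by rewrite divr_ge0 // ltW.
rewrite -subSn // subSS exprS.
apply: (@le_trans _ _ (c * (4 / gamma * c ^+ j * T))); last first.
  by rewrite le_eqVlt; apply/orP; left; apply/eqP; ring.
rewrite [leLHS]mulrA; apply: ler_pM; rewrite ?IH ?mulr_ge0 ?invr_ge0 ?(ltW gamma0) //; last exact: ltnW.
  by apply: sumr_ge0 => *; apply: square_defect_ge0.
rewrite /c; apply: (@le_trans _ _ ((12 * k.+1)%:R / gamma)); last by rewrite lerDr.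
rewrite mulrAC -natrM ler_wpM2r ?invr_ge0 ?(ltW gamma0) // ler_nat.
by lia.
Qed.

(** * Products of labels along chains *)

Fixpoint potential_rec n h r : G :=
  if n is n'.+1 then
    if [pick x in r] is Some x then (potential_rec n' h (r :\ x) * h (r :\ x) x)%g else 1%g
  else 1%g.
(** The chain is the one that [pick] happens to produce; the size of [r] is the fuel of the
    recursion. *)
Definition potential h r := potential_rec #|r| h r.

Definition square_fails_below h r := [exists b : {set V}, exists x, exists y,
  [&& x \notin b, y \notin x |: b, y |: (x |: b) \subset r & square_fails h b x y]].

Lemma square_fails_belowS h r r' : r \subset r' ->
  square_fails_below h r -> square_fails_below h r'.
Proof.
move=> rr' /existsP[b /existsP[x /existsP[y /and4P[xb yb br f]]]].
apply/existsP; exists b; apply/existsP; exists x; apply/existsP; exists y.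
by rewrite xb yb f (subset_trans br rr').
Qed.

(** If the chosen chain removes [z != x] first, then by induction both [potential h (r :\ z)] and
    [potential h (r :\ x)] factor through [r :\ z :\ x], and the square from there to [r]
    commutes. *)
Lemma potentialE h r x : ~~ square_fails_below h r -> x \in r ->
  potential h r = (potential h (r :\ x) * h (r :\ x) x)%g.
Proof.
move: {2}#|r| (erefl #|r|) => n; elim: n r x => [|n IH] r x rn good xr.
  by move/eqP: rn xr; rewrite cards_eq0 => /eqP ->; rewrite inE.
have goodD z : ~~ square_fails_below h (r :\ z).
  by apply: contra good; apply: square_fails_belowS; apply: subD1set.
have cardD z : z \in r -> #|r :\ z| = n.
  by move=> zr; have := cardsD1 z r; rewrite rn zr => -[].
rewrite {1}/potential rn /=; case: pickP => [z zr|]; last by move=> /(_ x); rewrite xr.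
rewrite -[X in potential_rec X](cardD z zr) -/(potential h (r :\ z)).
have [-> //|zx] := eqVneq z x.
have xz : x \in r :\ z by rewrite !inE eq_sym zx.
have zx' : z \in r :\ x by rewrite !inE zx.
rewrite (IH _ x (cardD z zr) (goodD z) xz) (IH _ z (cardD x xr) (goodD x) zx').
rewrite [r :\ x :\ z]setD1C -!mulgA; congr (_ * _)%g; apply/eqP; apply: contraNT good => f.
apply/existsP; exists (r :\ z :\ x); apply/existsP; exists x; apply/existsP; exists z.
have e1 : x |: (r :\ z :\ x) = r :\ z by rewrite setD1K.
have e2 : z |: (r :\ z :\ x) = r :\ x by rewrite setD1C setD1K.
by rewrite /square_fails e1 e2 f setD1K // subxx !inE !eqxx.
Qed.

(** A failing square below [r] either has [r] as its top or misses some [z] in [r] and lies below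
    [r :\ z]. The factor [s.+2] is the relative weight of all extensions of a set of size [s.+1]. *)
Lemma sum_square_fails_below_le h s : (s < d)%N ->
  \sum_(r : {set V} | #|r| == s.+2) W r * (square_fails_below h r)%:R <=
  s.+2%:R * \sum_(r : {set V} | #|r| == s.+1) W r * (square_fails_below h r)%:R +
  \sum_(b : {set V} | #|b| == s) square_defect h b.
Proof.
move=> sd.
pose bad r : R := (square_fails_below h r)%:R.
have E1 : s.+2%:R * \sum_(r : {set V} | #|r| == s.+1) W r * bad r =
    \sum_(r : {set V} | #|r| == s.+2) \sum_(x in r) W r * bad (r :\ x).
  rewrite mulr_sumr; transitivity (\sum_(r : {set V} | #|r| == s.+2) \sum_(x in r)
      W (x |: (r :\ x)) * bad (r :\ x)); last first.
    by apply: eq_bigr => r _; apply: eq_bigr => x xr; rewrite setD1K.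
  rewrite (sum_facets _ (fun b x => W (x |: b) * bad b)).
  by apply: eq_bigr => r /eqP rs; rewrite sum_weight_up rs.
have E2 : \sum_(b : {set V} | #|b| == s) square_defect h b =
    \sum_(r : {set V} | #|r| == s.+2) \sum_(y in r) \sum_(x in r :\ y)
      W r * (square_fails h (r :\ y :\ x) x y)%:R.
  rewrite -(sum_facets2 s (fun b x y => W (y |: (x |: b)) * (square_fails h b x y)%:R)).
  do 2 (apply: eq_bigr => ? ?); apply: eq_bigr => x xr.
  by rewrite !setD1K.
rewrite E1 E2 -big_split; apply: ler_sum => r _ /=.
rewrite [X in _ + X](eq_bigr (fun y => W r *
    \sum_(x in r :\ y) (square_fails h (r :\ y :\ x) x y)%:R)); last first.
  by move=> y yr; rewrite mulr_sumr.
rewrite -!mulr_sumr -mulrDr ler_wpM2l ?weight_ge0 //.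
have ge0 (T : finType) (P Q : pred T) : 0 <= \sum_(x | P x) (Q x)%:R :> R by apply: sumr_ge0.
case: (boolP (square_fails_below h r)) => [|_]; last first.
  by apply: addr_ge0; [exact: ge0 | apply: sumr_ge0 => *; exact: ge0].
case/existsP=> b /existsP[x /existsP[y /and4P[xb yb br f1]]].
have [e|] := eqVneq (y |: (x |: b)) r.
  have yr : y \in r by rewrite -e setU11.
  have ey : r :\ y = x |: b by rewrite -e setU1K.
  have ex : r :\ y :\ x = b by rewrite ey setU1K.
  rewrite [X in _ + X](bigD1 y) //= [X in _ + (X + _)](bigD1 x) /=; last by rewrite ey setU11.
  rewrite ex f1 addrCA -addrA lerDl addr_ge0 ?ge0 // addr_ge0 ?ge0 //.
  by apply: sumr_ge0 => *; exact: ge0.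
rewrite eqEsubset br /= => /subsetPn [z zr zb].
rewrite (bigD1 z) //= /bad.
have -> : square_fails_below h (r :\ z).
  apply/existsP; exists b; apply/existsP; exists x; apply/existsP; exists y.
  by rewrite xb yb f1 subsetD1 br zb.
by rewrite -addrA lerDl addr_ge0 ?ge0 // sumr_ge0 // => *; exact: ge0.
Qed.

Lemma square_fails_below_small h r : (#|r| < 2)%N -> square_fails_below h r = false.
Proof.
move=> r2; apply/existsP => -[b /existsP[x /existsP[y /and4P[xb yb br _]]]].
by have := subset_leq_card br; rewrite !cardsU1 xb yb; lia.
Qed.

Lemma sum_square_fails_below_bound h k K : (k < d)%N ->
  (forall s, (s < k)%N -> \sum_(b : {set V} | #|b| == s) square_defect h b <= K) ->
  0 <= K ->
  \sum_(r : {set V} | #|r| == k.+1) W r * (square_fails_below h r)%:R <= (k.+2)`!%:R * K.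
Proof.
move=> kd hK K0; suff: forall n, (n <= k.+1)%N ->
  \sum_(r : {set V} | #|r| == n) W r * (square_fails_below h r)%:R <= (n.+1)`!%:R * K by exact.
have small n : (n < 2)%N ->
    \sum_(r : {set V} | #|r| == n) W r * (square_fails_below h r)%:R <= (n.+1)`!%:R * K.
  move=> n2; rewrite big1 ?mulr_ge0 // => r /eqP rn.
  by rewrite square_fails_below_small ?mulr0 // rn.
case=> [|n]; first by rewrite small.
elim: n => [|n IH] nk; first by rewrite small.
apply: (le_trans (sum_square_fails_below_le h _)); first by lia.
apply: (@le_trans _ _ (n.+2%:R * ((n.+2)`!%:R * K) + K)).
  by rewrite lerD ?ler_wpM2l ?IH ?hK //; lia.
(* The factorials absorb the recursion: [n.+2 * (n.+2)! + 1 <= n.+3 * (n.+2)!]. *)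
rewrite [(n.+3)`!]factS mulrA -[X in _ + X]mul1r -mulrDl ler_wpM2r // -natrM natr1 ler_nat.
by rewrite [leqRHS]mulSn -add1n leq_add2r fact_gt0.
Qed.

End Labels.

(** * The tester *)

Lemma locdiffPn (V : finType) (s : {set V}) (f g : V -> bool) :
  reflect {in s, f =1 g} (~~ locdiff s f g).
Proof.
rewrite /locdiff negb_exists; apply: (iffP forallP) => [h x xs|h x].
  by have := h x; rewrite xs /= negbK => /eqP.
by rewrite negb_and negbK; case: (boolP (x \in s)) => //= xs; rewrite h.
Qed.

Section Tester.
Variables (V : finType) (l : nat).
Local Notation G := {perm 'I_l}.
Local Notation answer := {ffun V -> bool}.

(** A non-adaptive algorithm: the queries are fixed in advance and only [decide] sees the
    answers. *)
Fixpoint ask (qs : seq ({set V} * 'I_l)) (decide : seq answer -> bool) : qtree V l :=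
  if qs is q :: qs' then QAsk q.1 q.2 (fun a => ask qs' (fun aa => decide (a :: aa)))
  else QLeaf V l (decide [::]).

Lemma depth_ask qs decide n : (size qs <= n)%N -> depth_le (ask qs decide) n.
Proof. by elim: qs decide n => [|q qs IH] decide [|n] //= qn a; apply: IH. Qed.

Definition query X k (L : lassignment V l) (q : {set V} * 'I_l) : answer :=
  [ffun x => [&& q.1 \in faces X k, x \in q.1 & L q.1 q.2 x]].

Lemma run_ask X k qs decide L : run X k (ask qs decide) L = decide (map (query X k L) qs).
Proof. by elim: qs decide => [//|q qs IH] decide /=; rewrite IH. Qed.

Definition consistent3 (A : lassignment V l) (s1 s2 s3 : {set V}) :=
  [exists p1 : G, exists p2 : G, exists p3 : G, forall i,
    [&& ~~ locdiff (s1 :&: s2) (A s1 (p1 i)) (A s2 (p2 i)),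
        ~~ locdiff (s2 :&: s3) (A s2 (p2 i)) (A s3 (p3 i)) &
        ~~ locdiff (s1 :&: s3) (A s1 (p1 i)) (A s3 (p3 i))]].

(** Triples containing a non-face are accepted, which keeps the test complete on arbitrary triples
    of sets. *)
Definition triple_accepts X k L (t : {set V} * {set V} * {set V}) :=
  [&& t.1.1 \in faces X k, t.1.2 \in faces X k & t.2 \in faces X k] ==>
  consistent3 L t.1.1 t.1.2 t.2.

Lemma triple_acceptsP X k L s1 s2 s3 : s1 \in faces X k -> s2 \in faces X k ->
  s3 \in faces X k -> triple_accepts X k L (s1, s2, s3) ->
  exists p1 p2 p3 : G, forall i,
    [/\ {in s1 :&: s2, L s1 (p1 i) =1 L s2 (p2 i)},
        {in s2 :&: s3, L s2 (p2 i) =1 L s3 (p3 i)} &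
        {in s1 :&: s3, L s1 (p1 i) =1 L s3 (p3 i)}].
Proof.
rewrite /triple_accepts /= => -> -> -> /existsP[p1 /existsP[p2 /existsP[p3 /forallP h]]].
exists p1, p2, p3 => i.
by have /and3P[/locdiffPn ? /locdiffPn ? /locdiffPn ?] := h i.
Qed.

Definition triple_queries (t : {set V} * {set V} * {set V}) : seq ({set V} * 'I_l) :=
  [seq (s, i) | s <- [:: t.1.1; t.1.2; t.2], i <- enum 'I_l].

Definition triple_tree X k (t : {set V} * {set V} * {set V}) : qtree V l :=
  ask (triple_queries t) (fun aa => triple_accepts X k
    (fun s i => nth [ffun=> false] aa (index (s, i) (triple_queries t))) t).

Lemma depth_triple_tree X k t : depth_le (triple_tree X k t) (3 * l).
Proof. by apply: depth_ask; rewrite size_allpairs size_enum_ord. Qed.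

(** Answers are padded outside their face, but the test compares them only on intersections, where
    they coincide with [L]. If a face is repeated, [index] finds its first copy. *)
Lemma run_triple_tree X k t L : run X k (triple_tree X k t) L = triple_accepts X k L t.
Proof.
rewrite run_ask /triple_accepts; case: and3P => //= -[s1 s2 s3].
have E s i x : s \in [:: t.1.1; t.1.2; t.2] -> x \in s ->
  nth [ffun=> false] (map (query X k L) (triple_queries t)) (index (s, i) (triple_queries t)) x
  = L s i x.
  move=> st xs; have st' : (s, i) \in triple_queries t.
    by apply/allpairsP; exists (s, i); rewrite mem_enum.
  rewrite (nth_map (s, i)) ?index_mem // nth_index // ffunE /= xs.
  have -> : s \in faces X k by move: st; rewrite !in_cons in_nil orbF => /or3P[] /eqP ->.
  by [].
have E' s s' i j : s \in [:: t.1.1; t.1.2; t.2] -> s' \in [:: t.1.1; t.1.2; t.2] ->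
  locdiff (s :&: s')
   (nth [ffun=> false] (map (query X k L) (triple_queries t)) (index (s, i) (triple_queries t)))
   (nth [ffun=> false] (map (query X k L) (triple_queries t)) (index (s', j) (triple_queries t)))
  = locdiff (s :&: s') (L s i) (L s' j).
  move=> st s't; apply: eq_existsb => x; case: (boolP (x \in _)) => //=.
  by rewrite inE => /andP[xs xs']; rewrite !E.
apply: eq_existsb => p1; apply: eq_existsb => p2; apply: eq_existsb => p3.
by apply: eq_forallb => i; rewrite !E' // !inE eqxx ?orbT.
Qed.

Lemma triple_accepts_agreeing X k L t : agreeing_l X k L -> triple_accepts X k L t.
Proof.
case=> g [p gp]; apply/implyP => /and3P[s1 s2 s3].
apply/existsP; exists (p t.1.1); apply/existsP; exists (p t.1.2); apply/existsP; exists (p t.2).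
apply/forallP => i; apply/and3P.
by split; apply/locdiffPn => x; rewrite inE => /andP[xs xs']; rewrite !gp.
Qed.

(** The weights [mu] are divided by [M] and the missing probability goes to a leaf that always
    accepts, so the rejection probability is exactly the rejected mass over [M]. *)
Lemma triple_tester (R : realType) X k (T : finType) (mu : T -> R) (M : R)
    (t : T -> {set V} * {set V} * {set V}) :
  (forall w, 0 <= mu w) -> 0 < M -> \sum_w mu w <= M ->
  exists (n : nat) (p : 'I_n -> R) (Q : 'I_n -> qtree V l),
    [/\ forall j, 0 <= p j, \sum_(j < n) p j = 1, forall j, depth_le (Q j) (3 * l),
      forall L, agreeing_l X k L -> accept_prob X k p Q L = 1 &
      forall L, M * (1 - accept_prob X k p Q L) =
                \sum_w mu w * (~~ triple_accepts X k L (t w))%:R].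
Proof.
move=> mu0 M0 muM.
pose q (o : unit + T) := if o is inr w then mu w / M else 1 - (\sum_w mu w) / M.
pose S (o : unit + T) := if o is inr w then triple_tree X k (t w) else QLeaf V l true.
have sumq : \sum_o q o = 1.
  rewrite big_sumType /= (big_pred1 tt) => [|[]] //.
  by rewrite -mulr_suml subrK.
have accE L : accept_prob X k (fun j : 'I_#|{: unit + T}| => q (enum_val j))
    (fun j => S (enum_val j)) L = \sum_o q o * (run X k (S o) L)%:R.
  by rewrite [RHS]big_enum_val.
exists #|{: unit + T}|, (fun j => q (enum_val j)), (fun j => S (enum_val j)); split.
- move=> j; rewrite /q; case: (enum_val j) => [_|w]; last by rewrite divr_ge0 // ltW.
  by rewrite subr_ge0 ler_pdivrMr // mul1r.
- by rewrite -[RHS]sumq [RHS]big_enum_val.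
- by move=> j; rewrite /S; case: (enum_val j) => [_ //|w]; exact: depth_triple_tree.
- move=> L aL; rewrite accE -[RHS]sumq; apply: eq_bigr => -[_|w] _ /=; rewrite ?mulr1 //.
  by rewrite run_triple_tree triple_accepts_agreeing ?mulr1.
- move=> L; rewrite accE -{1}sumq -sumrB big_sumType /= big1 ?add0r => [|_ _]; last first.
    by rewrite mulr1 subrr.
  rewrite mulr_sumr; apply: eq_bigr => w _; rewrite run_triple_tree.
  rewrite -{1}[_ / M]mulr1 -mulrBr mulrA mulrCA divff ?gt_eqF // mulr1.
  by case: triple_accepts; rewrite ?subrr ?subr0.
Qed.

End Tester.

(** * Labels from lists *)

Lemma exists_le_average (R : realType) (T : finType) (t0 : T) (P : pred T) (w A : T -> R) :
  (forall t, 0 <= w t) ->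
  exists t, (\sum_(u | P u) w u) * A t <= \sum_(u | P u) w u * A u.
Proof.
move=> w0; have [t _ At] := @arg_minP _ _ T t0 xpredT A isT.
by exists t; rewrite mulr_suml; apply: ler_sum => u _; rewrite ler_wpM2l ?At.
Qed.

(** Counterpart of [triangle_of_squares] at the top level, where the reindexings [p1], [p2], [p3] of
    the faces [b+x+y], [b+y+z], [b+x+z] found by the test replace the labels into the triangle. *)
Lemma triangle_of_transitions (gT : finGroupType) (xy xz yx yz zx zy p1 p2 p3 : gT) :
  (xy^-1 * xz = p1^-1 * p3 -> yx^-1 * yz = p1^-1 * p2 -> zy^-1 * zx = p2^-1 * p3 ->
   xy * yx^-1 * (yz * zy^-1) * (zx * xz^-1) = 1)%g.
Proof.
move=> ex ey ez.
have -> : (xy * yx^-1 * (yz * zy^-1) * (zx * xz^-1) =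
  xy * (yx^-1 * yz) * (zy^-1 * zx) * xz^-1)%g by rewrite !mulgA.
rewrite ey ez.
have -> : (xy * (p1^-1 * p2) * (p2^-1 * p3) * xz^-1 = xy * (p1^-1 * p3) * xz^-1)%g.
  by rewrite !mulgA mulgK.
by rewrite -ex mulKVg mulgV.
Qed.

Lemma sum3_perms (V : finType) (M : nmodType) (b : {set V}) (F : V -> V -> V -> M) :
  [/\ sum3 b (fun x y z => F x z y) = sum3 b F, sum3 b (fun x y z => F y x z) = sum3 b F,
      sum3 b (fun x y z => F y z x) = sum3 b F, sum3 b (fun x y z => F z x y) = sum3 b F &
      sum3 b (fun x y z => F z y x) = sum3 b F].
Proof.
have e23 (F' : V -> V -> V -> M) : sum3 b (fun x y z => F' x z y) = sum3 b F' by rewrite -sum3_swap23.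
have e12 (F' : V -> V -> V -> M) : sum3 b (fun x y z => F' y x z) = sum3 b F' by rewrite -sum3_swap12.
split=> //.
- by rewrite (e12 (fun x y z => F x z y)).
- by rewrite (e23 (fun x y z => F y x z)).
- by rewrite (e23 (fun x y z => F y z x)) (e12 (fun x y z => F x z y)).
Qed.

Section Base.
Variables (R : realType) (V : finType) (X : {set {set V}}) (d l k' : nat).
Hypothesis X_closed : closed_under_subsets X.
Local Notation k := k'.+1.
Hypothesis kd : (k < d)%N.
Local Notation W := (weight R X d).
Local Notation G := {perm 'I_l}.
Implicit Types (a b s : {set V}) (L lam : lassignment V l).

(** [ref] is a candidate for the list on [a]; [p] reorders the list of [u |: a] so that it restricts
    to [ref]. *)
Definition matching L (ref : 'I_l -> V -> bool) a u (p : G) :=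
  [forall i, ~~ locdiff a (L (u |: a) (p i)) (ref i)].

Definition unmatched L ref a u := ~~ [exists p, matching L ref a u p].

Definition matching_label L lam a u : G := odflt 1%g [pick p | matching L (lam a) a u p].

Lemma matching_labelP L lam a u : ~~ unmatched L (lam a) a u ->
  forall i, {in a, L (u |: a) (matching_label L lam a u i) =1 lam a i}.
Proof.
rewrite negbK /matching_label => /existsP[p pm] i; case: pickP => [q /forallP qm|/(_ p)].
  exact/locdiffPn.
by rewrite pm.
Qed.

Lemma unmatched_rejects L a y z : y |: a \in faces X k -> z |: a \in faces X k ->
  unmatched L (L (y |: a)) a z -> ~~ triple_accepts X k L (y |: a, z |: a, z |: a).
Proof.
move=> yF zF; apply: contra => /(triple_acceptsP yF zF zF) [p1 [p2 [p3 h]]].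
apply/existsP; exists (p1^-1 * p2)%g; apply/forallP => i; apply/locdiffPn => x xa.
have [h1 _ _] := h (p1^-1 i)%g; rewrite permM -h1 ?permKV //.
by rewrite !inE xa !orbT.
Qed.

Definition unmatched_mass L lam : R :=
  \sum_(a : {set V} | #|a| == k) \sum_(u | u \notin a)
    W (u |: a) * (unmatched L (lam a) a u)%:R.

(* The face [z |: a] is repeated to fit the three-face test; terms with
   [W a = 0] vanish, since then [W (y |: a) = 0]. *)
Definition reject_mass1 L : R :=
  \sum_(a : {set V} | #|a| == k) \sum_(y | y \notin a) \sum_(z | z \notin a)
    W (y |: a) * W (z |: a) / W a *
    (~~ triple_accepts X k L (y |: a, z |: a, z |: a))%:R.

Definition reject_mass2 L : R :=
  \sum_(b : {set V} | #|b| == k') sum3 b (fun x y z =>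
    W (z |: (y |: (x |: b))) *
    (~~ triple_accepts X k L (y |: (x |: b), z |: (y |: b), z |: (x |: b)))%:R).

Lemma face_up a u : #|a| = k -> u \notin a -> W (u |: a) != 0 -> u |: a \in faces X k.
Proof. by move=> ak ua /(weight_neq0 X_closed) uX; rewrite inE uX cardsU1 ua ak add1n eqxx. Qed.

(** The list of some [v |: a] is matched at least as well as the list of a [y |: a] is on average
    over [y], and every mismatch between [y |: a] and [z |: a] is rejected by the test. *)
Lemma exists_reference L : exists lam, unmatched_mass L lam <= reject_mass1 L.
Proof.
have /fin_all_exists [lam hlam] a : exists ref : 'I_l -> V -> bool, #|a| = k ->
    \sum_(u | u \notin a) W (u |: a) * (unmatched L ref a u)%:R <=
    \sum_(y | y \notin a) \sum_(z | z \notin a) W (y |: a) * W (z |: a) / W a *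
      (~~ triple_accepts X k L (y |: a, z |: a, z |: a))%:R.
  have [ak|/eqP ak] := eqVneq #|a| k; last by exists (L a) => /ak.
  (* This only shows that [V] is inhabited; the minimizing [v] ranges over all of [V]. *)
  have [v0 _] : exists v0, v0 \in a by apply/set0Pn; rewrite -card_gt0 ak.
  pose A v : R := \sum_(u | u \notin a) W (u |: a) * (unmatched L (L (v |: a)) a u)%:R.
  have [v] := @exists_le_average R V v0 (fun v => v \notin a) (fun v => W (v |: a)) A
    (fun v => weight_ge0 R X d _).
  rewrite weight_up ?ak; last by lia.
  move=> hv; exists (L (v |: a)) => _; rewrite -/(A v).
  have [W0|W0] := eqVneq (W a) 0.
    rewrite /A big1 => [|u ua].
      do 2 (apply: sumr_ge0 => ? _); apply: mulr_ge0 => //.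
      by apply: divr_ge0; [apply: mulr_ge0|]; exact: weight_ge0.
    have := @sum_weight_up R V X d a 1; rewrite ak W0 !mul0r mulr0 => /(_ (ltnW kd)) /eqP.
    rewrite psumr_eq0 => [/allP /(_ u (mem_index_enum u))|? _]; last by rewrite mulr1 weight_ge0.
    by rewrite ua mulr1 /= => /eqP ->; rewrite mul0r.
  have Wa : 0 < W a by rewrite lt_def W0 weight_ge0.
  have Av : 0 <= A v by apply: sumr_ge0 => *; rewrite mulr_ge0 ?weight_ge0.
  rewrite -(ler_pM2l Wa); apply: le_trans (le_trans hv _).
    (* The sets [v |: a] weigh [k.+1] times [W a] in total; this factor is given up. *)
    by rewrite ler_wpM2r // -{1}[W a]mulr1n ler_pMn2l.
  rewrite mulr_sumr; apply: ler_sum => y ya; rewrite /A !mulr_sumr.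
  apply: ler_sum => z za.
  have -> : W a * (W (y |: a) * W (z |: a) / W a *
      (~~ triple_accepts X k L (y |: a, z |: a, z |: a))%:R) =
      W (y |: a) * (W (z |: a) * (~~ triple_accepts X k L (y |: a, z |: a, z |: a))%:R).
    by move: W0; move: (W a) => w W0; field.
  have [->|Wy] := eqVneq (W (y |: a)) 0; first by rewrite !mul0r.
  have [->|Wz] := eqVneq (W (z |: a)) 0; first by rewrite !mul0r !mulr0.
  rewrite !ler_wpM2l ?weight_ge0 // ler_nat.
  case: (boolP (unmatched _ _ _ _)) => // um.
  by rewrite (unmatched_rejects _ _ um) ?face_up.
by exists lam; apply: ler_sum => a /eqP ak; exact: hlam.
Qed.

(** * Comparing labels with the answers of the test *)

Section Reference.
Variables (L lam : lassignment V l).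
Hypothesis L_diff : two_loc_diff X k L.
Local Notation um a u := (unmatched L (lam a) a u).
Local Notation lab := (matching_label L lam).

(** Two functions in the list of [v |: a] that agree on [a] can differ only at [v], so by 2-local
    difference they have the same index. Hence any reindexing consistent on [a] induces the same
    passage from [u |: a] to [v |: a]. *)
Lemma transition a u v (p q : G) : #|a| = k -> u |: a \in faces X k -> v |: a \in faces X k ->
  ~~ um a u -> ~~ um a v ->
  (forall i, {in a, L (u |: a) (p i) =1 L (v |: a) (q i)}) ->
  ((lab a u)^-1 * lab a v = p^-1 * q)%g.
Proof.
move=> ak uF vF /matching_labelP mu /matching_labelP mv pq.
apply/permP => j; rewrite !permM.
apply/eqP; apply: contraT => /(L_diff vF) [x1 [x2 [x1v x2v x12 d1 d2]]].
have e x : x \in a -> L (v |: a) (lab a v ((lab a u)^-1 j))%g x = L (v |: a) (q (p^-1 j))%g x.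
  by move=> xa; rewrite mv // -mu // -pq // !permKV.
move: x1v x2v; rewrite !inE => /predU1P[x1v|/e x1a]; last by rewrite x1a eqxx in d1.
move=> /predU1P[x2v|/e x2a]; last by rewrite x2a eqxx in d2.
by rewrite x1v x2v eqxx in x12.
Qed.

(** If the test accepts and all six labels match, [transition] at [x |: b], [y |: b] and [z |: b]
    gives the three hypotheses of [triangle_of_transitions]. *)
Lemma triangle_fails_le b x y z : #|b| = k' -> x \notin b -> y \notin x |: b ->
  z \notin y |: (x |: b) -> z |: (y |: (x |: b)) \in X ->
  d1 (link_cochain lab b) x y z != 1%g ->
  [|| ~~ triple_accepts X k L (y |: (x |: b), z |: (y |: b), z |: (x |: b)),
    um (x |: b) y, um (x |: b) z, um (y |: b) x, um (y |: b) z, um (z |: b) x | um (z |: b) y].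
Proof.
move=> bk xb; rewrite !inE !negb_or => /andP[yx yb] /and3P[zy zx zb] tX.
have F u v w : [set u; v; w] = [set x; y; z] -> u != v -> u \notin b -> v \notin b ->
    u |: (v |: b) \in faces X k.
  move=> e uv ub vb; rewrite inE !cardsU1 vb !inE negb_or uv ub bk /= !add1n eqxx andbT.
  apply: (X_closed tX); rewrite setUA; apply: subset_trans (_ : [set u; v; w] :|: b \subset _).
    by rewrite setSU // subsetUl.
  by rewrite e; apply/subsetP => r; rewrite !inE; do 3 (case: eqP => //= _); rewrite ?orbT.
have xy : x != y by rewrite eq_sym.
have xz : x != z by rewrite eq_sym.
have yz : y != z by rewrite eq_sym.
have Fyx : y |: (x |: b) \in faces X k by apply: (@F y x z) => //; rewrite [[set y; x]]setUC.
have Fzy : z |: (y |: b) \in faces X k.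
  by apply: (@F z y x) => //; rewrite setUC setUA [[set x; z]]setUC [RHS]setUC setUA.
have Fzx : z |: (x |: b) \in faces X k.
  by apply: (@F z x y) => //; rewrite [[set z; x]]setUC -setUA [[set z] :|: _]setUC setUA.
apply: contraNT; rewrite !negb_or negbK.
move=> /and5P[/(triple_acceptsP Fyx Fzy Fzx) [p1 [p2 [p3 h]]] xy' xz' yx' /and3P[yz' zx' zy']].
have cu u : u \notin b -> #|u |: b| = k by move=> ub; rewrite cardsU1 ub bk.
apply/eqP; rewrite /d1 /link_cochain; apply: (@triangle_of_transitions _ _ _ _ _ _ _ p1 p2 p3).
- apply: transition; rewrite ?cu // => i v va; have [_ _ e] := h i; apply: e.
  by rewrite inE !(in_setU1 _ _ (x |: b)) va !orbT.
- apply: transition; rewrite ?cu // [x |: (y |: b)]setUCA // => i v va; have [e _ _] := h i; apply: e.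
  by rewrite -[y |: (x |: b)]setUCA inE !(in_setU1 _ _ (y |: b)) va !orbT.
- apply: transition; rewrite ?cu // ?[y |: (z |: b)]setUCA ?[x |: (z |: b)]setUCA // => i v va.
  have [_ e _] := h i; apply: e.
  by rewrite -[z |: (y |: b)]setUCA -[z |: (x |: b)]setUCA inE !(in_setU1 _ _ (z |: b)) va !orbT.
Qed.

(** Union bound over [triangle_fails_le]. The six unmatched terms have equal sums by symmetry; each
    sum carries [k.+2] for the free third vertex and [k] for the ways to write [a] as [x |: b]. *)
Lemma base_triangle_defect h : (forall a, #|a| = k -> h a =1 lab a) ->
  \sum_(b : {set V} | #|b| == k') triangle_defect R X d h b <=
  reject_mass2 L + (6 * k.+2 * k)%:R * unmatched_mass L lam.
Proof.
move=> hlab.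
pose F b x y z := W (z |: (y |: (x |: b))) * (um (x |: b) y)%:R.
have EF : \sum_(b : {set V} | #|b| == k') sum3 b (F b) = (k.+2 * k)%:R * unmatched_mass L lam.
  have -> : \sum_(b : {set V} | #|b| == k') sum3 b (F b) =
      \sum_(b : {set V} | #|b| == k') \sum_(x | x \notin b)
       (k.+2%:R * \sum_(y | y \notin x |: b) W (y |: (x |: b)) * (um (x |: b) y)%:R).
    apply: eq_bigr => b /eqP bk; apply: eq_bigr => x xb; rewrite mulr_sumr.
    apply: eq_bigr => y yb.
    have c : #|y |: (x |: b)| = k.+1 by rewrite !cardsU1 xb yb bk.
    by rewrite sum_weight_up c.
  rewrite (sum_extensions k' (fun a => k.+2%:R * \sum_(y | y \notin a) W (y |: a) * (um a y)%:R)).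
  by rewrite -mulr_sumr -/(unmatched_mass L lam) natrM -[LHS]mulr_natl; ring.
have -> : reject_mass2 L + (6 * k.+2 * k)%:R * unmatched_mass L lam =
   \sum_(b : {set V} | #|b| == k') (sum3 b (fun x y z => W (z |: (y |: (x |: b))) *
    (~~ triple_accepts X k L (y |: (x |: b), z |: (y |: b), z |: (x |: b)))%:R)
    + sum3 b (F b) + sum3 b (F b) + sum3 b (F b) + sum3 b (F b) + sum3 b (F b) + sum3 b (F b)).
  rewrite !big_split /= -/(reject_mass2 L) EF -mulnA natrM.
  by move: (reject_mass2 L) (unmatched_mass L lam) => r u; ring.
apply: ler_sum => b /eqP bk.
have [e1 e2 e3 e4 e5] := sum3_perms b (F b).
rewrite -{2}e1 -{2}e2 -{2}e3 -{2}e4 -{2}e5 -!sum3D.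
have hx x : x \notin b -> h (x |: b) =1 lab (x |: b).
  by move=> xb; apply: hlab; rewrite cardsU1 xb bk.
rewrite (eq_triangle_defect R X d hx); apply: ler_sum3 => x y z xb yb zb.
have tE u v w : [set u; v; w] = [set x; y; z] -> w |: (v |: (u |: b)) = z |: (y |: (x |: b)).
  have cons3 p q r : r |: (q |: (p |: b)) = b :|: [set p; q; r].
    by rewrite [RHS]setUA setU2_cons [RHS]setUC.
  by rewrite !cons3 => ->.
rewrite /F !(tE x z y) ?(tE y x z) ?(tE y z x) ?(tE z x y) ?(tE z y x); first last.
- by rewrite setUAC.
- by apply/setP => r; rewrite !inE; do 3 (case: eqP => //= _).
- by apply/setP => r; rewrite !inE; do 3 (case: eqP => //= _).
- by apply/setP => r; rewrite !inE; do 3 (case: eqP => //= _).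
- by apply/setP => r; rewrite !inE; do 3 (case: eqP => //= _).
have [->|W0] := eqVneq (W (z |: (y |: (x |: b)))) 0; first by rewrite !mul0r !addr0.
rewrite -!mulrDr ler_wpM2l ?weight_ge0 // -!natrD ler_nat.
case: (boolP (_ != _)) => // f.
have := triangle_fails_le bk xb yb zb (weight_neq0 X_closed W0) f.
move: (~~ triple_accepts _ _ _ _) (um (x |: b) y) (um (x |: b) z) (um (y |: b) x)
  (um (y |: b) z) (um (z |: b) x) (um (z |: b) y).
by do 7 case.
Qed.

End Reference.
End Base.

(** * Soundness *)

Section Soundness.
Variables (R : realType) (V : finType) (X : {set {set V}}) (d l k' : nat).
Hypothesis X_closed : closed_under_subsets X.
Local Notation k := k'.+1.
Hypothesis kd : (k < d)%N.
Local Notation W := (weight R X d).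
Local Notation G := {perm 'I_l}.
Implicit Types (a b s : {set V}) (L lam : lassignment V l).
(** Bound for the total weight of the two tests: [k.+1 ^ 2] for the pairs of faces above a common
    [a], the product for the ordered flags above [b]. *)
Local Notation mass := ((k.+1 ^ 2 + k.+2 * (k.+1 * k))%:R : R).

Lemma reject_mass1_ge0 L : 0 <= reject_mass1 R X d k' L.
Proof.
do 3 (apply: sumr_ge0 => ? _); apply: mulr_ge0 => //.
by apply: divr_ge0; [apply: mulr_ge0|]; exact: weight_ge0.
Qed.

Lemma reject_mass2_ge0 L : 0 <= reject_mass2 R X d k' L.
Proof. by do 4 (apply: sumr_ge0 => ? _); rewrite mulr_ge0 ?weight_ge0. Qed.

Lemma exists_tester :
  exists (n : nat) (p : 'I_n -> R) (Q : 'I_n -> qtree V l),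
    [/\ forall j, 0 <= p j, \sum_(j < n) p j = 1, forall j, depth_le (Q j) (3 * l),
      forall L, agreeing_l X k L -> accept_prob X k p Q L = 1 &
      forall L, mass * (1 - accept_prob X k p Q L) =
                reject_mass1 R X d k' L + reject_mass2 R X d k' L].
Proof.
(* Both tests are extended by weight [0] to all tuples, so that one finite type indexes them. *)
pose mu1 (w : {set V} * V * V) : R :=
  if ((#|w.1.1| == k) && (w.1.2 \notin w.1.1)) && (w.2 \notin w.1.1)
  then W (w.1.2 |: w.1.1) * W (w.2 |: w.1.1) / W w.1.1 else 0.
pose mu2 (w : {set V} * V * V * V) : R :=
  if (((#|w.1.1.1| == k') && (w.1.1.2 \notin w.1.1.1)) && (w.1.2 \notin w.1.1.2 |: w.1.1.1))
     && (w.2 \notin w.1.2 |: (w.1.1.2 |: w.1.1.1))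
  then W (w.2 |: (w.1.2 |: (w.1.1.2 |: w.1.1.1))) else 0.
have sum1 f : \sum_w mu1 w * f w = \sum_(a : {set V} | #|a| == k) \sum_(y | y \notin a)
    \sum_(z | z \notin a) W (y |: a) * W (z |: a) / W a * f (a, y, z).
  rewrite !pair_big_dep [RHS]big_mkcond /=; apply: eq_bigr => -[[a y] z] _ /=.
  by rewrite /mu1 /=; case: ifP; rewrite ?mul0r.
have sum2 f : \sum_w mu2 w * f w = \sum_(b : {set V} | #|b| == k') sum3 b (fun x y z =>
    W (z |: (y |: (x |: b))) * f (b, x, y, z)).
  rewrite /sum3 !pair_big_dep [RHS]big_mkcond /=; apply: eq_bigr => -[[[b x] y] z] _ /=.
  by rewrite /mu2 /=; case: ifP; rewrite ?mul0r.
pose mu (w : ({set V} * V * V) + ({set V} * V * V * V)) :=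
  match w with inl w => mu1 w | inr w => mu2 w end.
pose t (w : ({set V} * V * V) + ({set V} * V * V * V)) := match w with
  | inl w => (w.1.2 |: w.1.1, w.2 |: w.1.1, w.2 |: w.1.1)
  | inr w => (w.1.2 |: (w.1.1.2 |: w.1.1.1), w.2 |: (w.1.2 |: w.1.1.1),
              w.2 |: (w.1.1.2 |: w.1.1.1)) end.
have mu_ge0 w : 0 <= mu w.
  case: w => w /=; rewrite /mu1 /mu2; case: ifP => // _; last exact: weight_ge0.
  by apply: divr_ge0; [apply: mulr_ge0|]; exact: weight_ge0.
have mass_gt0 : 0 < mass by rewrite ltr0n.
have mu_le : \sum_w mu w <= mass.
  rewrite big_sumType /= natrD; apply: lerD.
    under eq_bigr do rewrite -[mu1 _]mulr1.
    rewrite sum1; apply: (@le_trans _ _ (\sum_(a : {set V} | #|a| == k) (k.+1 ^ 2)%:R * W a)).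
      apply: ler_sum => a /eqP ak.
      have -> : \sum_(y | y \notin a) \sum_(z | z \notin a) W (y |: a) * W (z |: a) / W a * 1
          = (W a *+ k.+1) * (W a *+ k.+1) / W a.
        have <- : \sum_(y | y \notin a) W (y |: a) = W a *+ k.+1.
          by rewrite weight_up ?ak // ltnW.
        rewrite 2!mulr_suml; apply: eq_bigr => y _.
        by rewrite mulr_sumr mulr_suml; apply: eq_bigr => z _; rewrite mulr1.
      have [->|W0] := eqVneq (W a) 0; first by rewrite mul0rn mul0r mul0r mulr0.
      rewrite -[W a *+ _]mulr_natl natrX le_eqVlt; apply/orP; left; apply/eqP.
      by move: W0; move: (W a) => w w0; field.
    rewrite -mulr_sumr -[leRHS]mulr1 ler_wpM2l // sum_weight_le1 //; lia.
  under eq_bigr do rewrite -[mu2 _]mulr1.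
  rewrite sum2; apply: (@le_trans _ _ (\sum_(b : {set V} | #|b| == k') (k.+2 * (k.+1 * k))%:R * W b)).
    apply: ler_sum => b /eqP bk; rewrite /sum3 le_eqVlt; apply/orP; left; apply/eqP.
    transitivity (\sum_(x | x \notin b) W (x |: b) * (k.+2 * k.+1)%:R).
      apply: eq_bigr => x xb; have c : #|x |: b| = k by rewrite cardsU1 xb bk.
      transitivity (\sum_(y | y \notin x |: b) W (y |: (x |: b)) * k.+2%:R).
        apply: eq_bigr => y yb; have c' : #|y |: (x |: b)| = k.+1 by rewrite cardsU1 yb c.
        by rewrite sum_weight_up c' // mulr1 mulrC.
      by rewrite sum_weight_up ?c 1?ltnW // natrM; ring.
    by rewrite sum_weight_up ?bk ?natrM; [ring | lia].
  by rewrite -mulr_sumr -[leRHS]mulr1 ler_wpM2l // sum_weight_le1 //; lia.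
have [n [p [Q [p0 p1 dQ complete sound]]]] := triple_tester l X k t mu_ge0 mass_gt0 mu_le.
exists n, p, Q; split=> // L; rewrite sound big_sumType /=.
by rewrite (sum1 (fun w => (~~ triple_accepts X k L (t (inl w)))%:R))
  (sum2 (fun w => (~~ triple_accepts X k L (t (inr w)))%:R)).
Qed.

(** * Splitting the lists into [l] ordinary assignments *)

Section Potential.
Variables (L lam : lassignment V l) (h : {set V} -> V -> G).
Hypothesis h_lab : forall a, #|a| = k -> h a =1 matching_label L lam a.

Definition relabelled (i : 'I_l) : assignment V := fun s => L s (potential h s i).

Local Notation bad_mass := (\sum_(r : {set V} | #|r| == k.+1) W r * (square_fails_below h r)%:R).

(** If none of the four events occurs, [potentialE] factors both potentials through
    [a = t :\ x :\ y], and both functions restrict on [a] to [lam a (potential h a i)]. *)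
Lemma relabelled_disagree i (t : {set V}) x y : #|t| = k.+2 -> x \in t -> y \in t :\ x ->
  locdiff ((t :\ x) :&: (t :\ y)) (relabelled i (t :\ x)) (relabelled i (t :\ y)) ->
  [|| square_fails_below h (t :\ x), unmatched L (lam (t :\ x :\ y)) (t :\ x :\ y) y,
      square_fails_below h (t :\ y) | unmatched L (lam (t :\ x :\ y)) (t :\ x :\ y) x].
Proof.
move=> tk xt yt; apply: contraTT; rewrite !negb_or => /and4P[gx my gy mx].
move: (yt); rewrite !inE => /andP[yx yt'].
have xt' : x \in t :\ y by rewrite !inE eq_sym yx.
have ak : #|t :\ x :\ y| = k.
  by have := cardsD1 y (t :\ x); have := cardsD1 x t; rewrite yt xt tk; lia.
apply/locdiffPn => v; rewrite !inE => /andP[/andP[vx vt] /andP[vy _]].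
have va : v \in t :\ x :\ y by rewrite !inE vx vy vt.
rewrite /relabelled (potentialE gx yt) (potentialE gy xt') [t :\ y :\ x]setD1C !permM !h_lab //.
have := matching_labelP my (potential h (t :\ x :\ y) i) va; rewrite setD1K // => ->.
have := matching_labelP mx (potential h (t :\ x :\ y) i) va.
by rewrite [t :\ x :\ y]setD1C setD1K // => ->.
Qed.

Lemma disagree_prob_relabelled i :
  disagree_prob R X d k (relabelled i) <=
  (2 * k.+2)%:R * (k.+1%:R * bad_mass + unmatched_mass R X d k' L lam).
Proof.
(* [T a y] collects the two bad events of the facet [y |: a]. The other facet [x |: a] contributes
   the same in total, whence the factor [2]. *)
pose T a y : R := (square_fails_below h (y |: a))%:R + (unmatched L (lam a) a y)%:R.
have half : \sum_(a : {set V} | #|a| == k) \sum_(y | y \notin a)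
    \sum_(x | x \notin y |: a) W (x |: (y |: a)) * T a y =
    k.+2%:R * (k.+1%:R * bad_mass + unmatched_mass R X d k' L lam).
  transitivity (\sum_(a : {set V} | #|a| == k) \sum_(y | y \notin a) k.+2%:R * (W (y |: a) * T a y)).
    apply: eq_bigr => a /eqP ak; apply: eq_bigr => y ya.
    have c : #|y |: a| = k.+1 by rewrite cardsU1 ya ak.
    by rewrite sum_weight_up c.
  have -> : k.+1%:R * bad_mass = \sum_(a : {set V} | #|a| == k) \sum_(y | y \notin a)
      W (y |: a) * (square_fails_below h (y |: a))%:R.
    by rewrite (sum_extensions k (fun r => W r * (square_fails_below h r)%:R)) mulr_natl.
  rewrite /unmatched_mass -big_split mulr_sumr; apply: eq_bigr => a _.
  rewrite -big_split mulr_sumr; apply: eq_bigr => y _ /=.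
  by rewrite /T mulrDr.
rewrite natrM -mulrA -half mulr_natl mulr2n.
rewrite [X in _ <= _ + X](eq_bigr (fun a => \sum_(y | y \notin a)
    \sum_(x | x \notin y |: a) W (x |: (y |: a)) * T a x)); last first.
  move=> a _; rewrite sum_swap; apply: eq_bigr => y _; apply: eq_bigr => x _.
  by rewrite setUCA.
rewrite -big_split; under [leRHS]eq_bigr => a _ do rewrite -big_split.
under [leRHS]eq_bigr => a _ do under eq_bigr => y _ do rewrite -big_split.
rewrite /= -(sum_facets2 k (fun a y x => W (x |: (y |: a)) * T a y + W (x |: (y |: a)) * T a x)).
rewrite /disagree_prob sum_faces //; apply: ler_sum => t /eqP tk.
rewrite [leRHS](eq_bigr (fun x => W t * \sum_(y in t :\ x) (T (t :\ x :\ y) y + T (t :\ x :\ y) x))).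
  rewrite -mulr_sumr ler_wpM2l ?weight_ge0 // ler_pdivrMr ?ltr0n //.
  apply: (@le_trans _ _ (\sum_(x in t) \sum_(y in t :\ x) (T (t :\ x :\ y) y + T (t :\ x :\ y) x))).
    rewrite -sum1dep_card natr_sum.
    rewrite pair_big_dep /= [leLHS]big_mkcond [leRHS]big_mkcond /=.
    apply: ler_sum => -[x y] _ /=; rewrite !inE eq_sym.
    have T0 a u : 0 <= T a u by rewrite addr_ge0.
    case: (boolP (x \in t)) => //= xt; case: (boolP (y \in t)) => //= yt; last by rewrite andbF.
    case: (boolP (y == x)) => //= yx; case: ifP => // ld; last by rewrite addr_ge0.
    have yt' : y \in t :\ x by rewrite !inE yx.
    have := relabelled_disagree tk xt yt' ld.
    rewrite /T setD1K // [t :\ x :\ y]setD1C setD1K ?inE 1?eq_sym ?yx //.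
    rewrite -!natrD ler1n.
    move: (square_fails_below _ _) (square_fails_below _ _) (unmatched _ _ _ _) (unmatched _ _ _ _).
    by do 4 case.
  (* The number of ordered pairs, by which the probability is normalized, is only used to be at
     least [1]. *)
  rewrite ler_peMr ?ler1n //; do 2 (apply: sumr_ge0 => ? _); apply: addr_ge0; exact: addr_ge0.
move=> x xt; rewrite mulr_sumr; apply: eq_bigr => y yt.
by rewrite !setD1K // -mulrDr.
Qed.

(** Agreement expansion gives a global [g i] near each relabelled assignment. With the potentials as
    permutations these form an agreeing list whose distance from [L] is the average of the [l]
    distances. *)
Lemma dist_agree_l_le (alpha D : R) : 0 < alpha -> (1 <= l)%N -> agreement_expander X d k alpha ->
  (forall i, disagree_prob R X d k (relabelled i) <= D) ->
  dist_agree_l R X d k L <= D / alpha.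
Proof.
move=> alpha0 l0 agr hD.
have /fin_all_exists [g hg] i : exists g : {ffun V -> bool},
    snorm R X d [set s in faces X k | locdiff s (relabelled i s) g] <= D / alpha.
  have [g eg] := exists_minf [ffun=> false] (fun g : {ffun V -> bool} =>
    snorm R X d [set s in faces X k | locdiff s (relabelled i s) g]).
  exists g; rewrite -eg ler_pdivlMr // mulrC.
  exact: le_trans (agr _) (hD i).
apply: le_trans (minf_le _ _ ([ffun i => g i], [ffun s => potential h s])) _ => /=.
have -> : dist_l R X d k L (agreeing_of [ffun i => g i] [ffun s => potential h s]) =
    (\sum_i snorm R X d [set s in faces X k | locdiff s (relabelled i s) (g i)]) / l%:R.
  rewrite /dist_l /snorm.
  rewrite [in RHS](eq_bigr (fun i => \sum_(s in faces X k)
      if locdiff s (relabelled i s) (g i) then W s else 0)); last first.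
    by move=> i _; rewrite -big_mkcondr; apply: eq_bigl => s; rewrite in_set.
  rewrite exchange_big mulr_suml; apply: eq_bigr => s sX /=.
  rewrite mulrA; congr (_ / _); rewrite -sum1dep_card natr_sum mulr_sumr big_mkcond /=.
  rewrite (reindex_inj (@perm_inj _ (potential h s))) /=; apply: eq_bigr => i _.
  by rewrite /agreeing_of /relabelled !ffunE permK mulr1.
rewrite ler_pdivrMr ?ltr0n //; apply: (le_trans (ler_sum _ (fun i _ => hg i))).
by rewrite sumr_const card_ord mulr_natr.
Qed.

End Potential.

(** * The constants and the final estimate *)

Definition defect_constant (gamma : R) : R :=
  4 / gamma * (1 + (12 * k)%:R / gamma) ^+ k' * (1 + (6 * k.+2 * k)%:R).

Definition soundness_constant (gamma : R) : R :=
  (2 * k.+2)%:R * (k.+1%:R * ((k.+2)`!%:R * defect_constant gamma) + 1).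

Lemma soundness_constant_gt0 gamma : 0 < gamma -> 0 < soundness_constant gamma.
Proof.
move=> g0; have c0 : 0 <= defect_constant gamma.
  by rewrite !mulr_ge0 ?exprn_ge0 ?addr_ge0 ?mulr_ge0 ?invr_ge0 // ltW.
by rewrite /soundness_constant mulr_gt0 ?ltr0n // ltr_wpDl ?ltr01 // mulr_ge0 // mulr_ge0.
Qed.

(** The rejected mass bounds in turn the unmatched mass, the triangle defect at level [k'], the
    square defects at all levels below [k], the weight of faces above failing squares, and the
    disagreement of each relabelled assignment. *)
Lemma dist_agree_l_le_reject (gamma alpha : R) L : 0 < gamma -> 0 < alpha -> (1 <= l)%N ->
  coboundary_expander l X d gamma -> agreement_expander X d k alpha -> two_loc_diff X k L ->
  dist_agree_l R X d k L <=
  soundness_constant gamma / alpha * (reject_mass1 R X d k' L + reject_mass2 R X d k' L).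
Proof.
move=> g0 al0 l0 cob agr Ld.
have [lam hlam] := exists_reference R X_closed kd L.
have [h [hk hb]] := @fill_labels R V X d l X_closed k gamma (matching_label L lam) g0 kd
   (fun b bX bd => proj2 (cob b bX bd)).
set rej := _ + _.
have r1 := reject_mass1_ge0 L; have r2 := reject_mass2_ge0 L.
have um_le : unmatched_mass R X d k' L lam <= rej by rewrite (le_trans hlam) // lerDl.
have tri : \sum_(b : {set V} | #|b| == k') triangle_defect R X d h b <=
    (1 + (6 * k.+2 * k)%:R) * rej.
  apply: (le_trans (base_triangle_defect R X_closed kd Ld hk)).
  by rewrite mulrDl mul1r lerD ?lerDr // ler_wpM2l.
have sq (s : nat) : (s < k)%N -> \sum_(b : {set V} | #|b| == s) square_defect R X d h b <=
    defect_constant gamma * rej.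
  move=> sk; rewrite /defect_constant -[_ * rej]mulrA.
  exact: (sum_square_defect_le g0 hb tri sk).
have rej0 : 0 <= rej by rewrite addr_ge0.
have K0 : 0 <= defect_constant gamma * rej.
  apply: le_trans (sq 0%N _) => //; apply: sumr_ge0 => b _.
  exact: square_defect_ge0.
have bad := sum_square_fails_below_bound kd sq K0.
rewrite mulrAC; apply: (@dist_agree_l_le L h alpha) => // i.
apply: (le_trans (disagree_prob_relabelled hk i)).
rewrite /soundness_constant -[leRHS]mulrA ler_wpM2l // [leRHS]mulrDl mul1r lerD //.
by rewrite -[leRHS]mulrA ler_wpM2l // -mulrA.
Qed.

End Soundness.

Theorem mainTheorem1 (R : realType) (k : nat) (gamma alpha : R) :
  (1 <= k)%N -> 0 < gamma -> 0 < alpha ->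
  exists beta : R, 0 < beta /\
  forall (V : finType) (l d : nat) (X : {set {set V}}),
    (1 <= l)%N -> pure_complex X d -> (k <= d.-1)%N ->
    @coboundary_expander R V l X d gamma ->
    agreement_expander X d k alpha ->
    exists (n : nat) (p : 'I_n -> R) (T : 'I_n -> qtree V l),
      (forall j, 0 <= p j) /\ \sum_(j < n) p j = 1 /\
      (forall j, depth_le (T j) (3 * l)) /\
      (forall L : lassignment V l, two_loc_diff X k L -> agreeing_l X k L ->
         accept_prob X k p T L = 1) /\
      (forall L : lassignment V l, two_loc_diff X k L ->
         1 - accept_prob X k p T L >= beta * dist_agree_l R X d k L).
Proof.
case: k => // k' _ g0 al0.
set mass : R := (k'.+2 ^ 2 + k'.+3 * (k'.+2 * k'.+1))%:R.
have mass0 : 0 < mass by rewrite ltr0n.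
have C0 := soundness_constant_gt0 k' g0.
(* The distance is at most [soundness_constant k' gamma / alpha] times the rejected mass, which is
   [mass] times the rejection probability. *)
exists (alpha / (soundness_constant k' gamma * mass)); split.
  by rewrite divr_gt0 // mulr_gt0.
move=> V l d X l0 [Xc _] kd cob agr.
(* As [k] is positive, the truncated predecessor in [k <= d.-1] causes no loss. *)
have kd' : (k'.+1 < d)%N by lia.
have [n [p [Q [p0 p1 dQ complete sound]]]] := @exists_tester R V X d l k' kd'.
exists n, p, Q; do 3 split=> //; split=> [L _|L Ld]; first exact: complete.
have := dist_agree_l_le_reject Xc kd' g0 al0 l0 cob agr Ld.
rewrite -sound -/mass => le.
apply: le_trans (ler_wpM2l _ le) _; first by apply: ltW; rewrite divr_gt0 // mulr_gt0.
have cancel (a c m q : R) : a != 0 -> c != 0 -> m != 0 -> a / (c * m) * (c / a * (m * q)) = q.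
  by move=> a0 c0 m0; field; rewrite ?a0 ?c0 ?m0.
by rewrite cancel ?gt_eqF.
Qed.
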